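(* Assume Setting (S) and $\gamma>4\alpha$. Then for every $\varepsilon\in\big(0,\frac{\gamma^2-16\alpha^2}{\gamma^2+16\alpha^2}\big)$ and every $T>\frac{2\pi}{\sqrt{\gamma^2(1-\varepsilon)-16\alpha^2(1+\varepsilon)}}$ there exist $n_0=n_0(\varepsilon)\in\mathbb{N}$, independent of $T$ and of the coefficients $C_n,D_n,R_n$, and a constant $c(T,\varepsilon)>0$ such that $$\int_0^\infty k(t)\big(|u_1^{n_0}(t)|^2+|u_2^{n_0}(t)|^2\big)dt\ \ge\ c(T,\varepsilon)\sum_{n=n_0}^\infty(1+e^{-2\operatorname{Im}\omega_nT})\big(|C_n|^2+|d_nD_n|^2\big).$$
   Context: Setting (S): $(\omega_n),(\zeta_n),(C_n),(D_n),(c_n),(d_n)$ ($n\ge1$) are complex sequences and $(r_n),(R_n)$ are real sequences. There are constants $\gamma>0$, $\alpha>0$, $\chi<0$, $n'\in\mathbb{N}$, $\mu>0$, $\nu>1/2$, $M>0$, $0<c_1\le c_2$ such that: (H1) $\liminf_{n\to\infty}(\operatorname{Re}\omega_{n+1}-\operatorname{Re}\omega_n)=\liminf_{n\to\infty}(\operatorname{Re}\zeta_{n+1}-\operatorname{Re}\zeta_n)=\gamma$; (H2) $\operatorname{Im}\omega_n\to\alpha$, $r_n\to\chi$, $\operatorname{Im}\zeta_n\to0$; (H3) $\omega_n\ne0$, $\zeta_n\neq0$, $c_1|\zeta_n|\le|d_n|\le c_2|\zeta_n|$ and $|c_n|\le M/|\omega_n|$ for all $n$; (H4) $|R_n|\le\mu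 n^{-\nu}(|C_n|^2+|d_nD_n|^2)^{1/2}$ for $n\ge n'$ and $|R_n|\le\mu(|C_n|^2+|d_nD_n|^2)^{1/2}$ for $n\le n'$; (H5) $\sum_n(|C_n|^2+|d_nD_n|^2)<\infty$. For $n_0\in\mathbb{N}$ and $t\in\mathbb{R}$, $u_1^{n_0}(t)=\sum_{n\ge n_0}\big(C_ne^{i\omega_nt}+\overline{C_n}e^{-i\overline{\omega_n}t}+R_ne^{r_nt}+D_ne^{i\zeta_nt}+\overline{D_n}e^{-i\overline{\zeta_n}t}\big)$, $u_2^{n_0}(t)=\sum_{n\ge n_0}\big(d_nD_ne^{i\zeta_nt}+\overline{d_nD_n}e^{-i\overline{\zeta_n}t}+c_nC_ne^{i\omega_nt}+\overline{c_nC_n}e^{-i\overline{\omega_n}t}\big)$. For $T>0$, $k(t):=\sin(\pi t/T)$ for $t\in[0,T]$ and $k(t):=0$ otherwise. *)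

(* Defs.v *)
From Stdlib Require Import Reals Lra Lia.
Open Scope R_scope.

Record Cpx := mkC { re : R; im : R }.

Definition Cadd (z w : Cpx) : Cpx := mkC (re z + re w) (im z + im w).
Definition Cmul (z w : Cpx) : Cpx :=
  mkC (re z * re w - im z * im w) (re z * im w + im z * re w).
Definition Cconj (z : Cpx) : Cpx := mkC (re z) (- im z).
Definition RtoC (x : R) : Cpx := mkC x 0.
Definition Ci : Cpx := mkC 0 1.
Definition Cnorm2 (z : Cpx) : R := re z * re z + im z * im z.
Definition Cabs (z : Cpx) : R := sqrt (Cnorm2 z).
Definition Cexp (z : Cpx) : Cpx := mkC (exp (re z) * cos (im z)) (exp (re z) * sin (im z)).
Definition Czero : Cpx := mkC 0 0.

Fixpoint CsumN (f : nat -> Cpx) (N : nat) : Cpx :=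
  match N with
  | O => f O
  | S N' => Cadd (CsumN f N') (f (S N'))
  end.

Definition liminf_eq (u : nat -> R) (l : R) : Prop :=
  (forall eps, 0 < eps -> exists N, forall n, (N <= n)%nat -> l - eps < u n) /\
  (forall eps, 0 < eps -> forall N, exists n, (N <= n)%nat /\ u n < l + eps).

Definition kweight (T t : R) : R :=
  if Rle_dec 0 t then (if Rle_dec t T then sin (PI * t / T) else 0) else 0.

Definition u1_term (om ze C D : nat -> Cpx) (R_ r : nat -> R) (n : nat) (t : R) : Cpx :=
  Cadd (Cmul (C n) (Cexp (Cmul Ci (Cmul (om n) (RtoC t)))))
  (Cadd (Cmul (Cconj (C n)) (Cexp (Cmul (Cmul (RtoC (-1)) Ci) (Cmul (Cconj (om n)) (RtoC t)))))
  (Cadd (RtoC (R_ n * exp (r n * t)))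
  (Cadd (Cmul (D n) (Cexp (Cmul Ci (Cmul (ze n) (RtoC t)))))
        (Cmul (Cconj (D n)) (Cexp (Cmul (Cmul (RtoC (-1)) Ci) (Cmul (Cconj (ze n)) (RtoC t)))))))).

Definition u2_term (om ze C D c d : nat -> Cpx) (n : nat) (t : R) : Cpx :=
  Cadd (Cmul (Cmul (d n) (D n)) (Cexp (Cmul Ci (Cmul (ze n) (RtoC t)))))
  (Cadd (Cmul (Cconj (Cmul (d n) (D n))) (Cexp (Cmul (Cmul (RtoC (-1)) Ci) (Cmul (Cconj (ze n)) (RtoC t)))))
  (Cadd (Cmul (Cmul (c n) (C n)) (Cexp (Cmul Ci (Cmul (om n) (RtoC t)))))
        (Cmul (Cconj (Cmul (c n) (C n))) (Cexp (Cmul (Cmul (RtoC (-1)) Ci) (Cmul (Cconj (om n)) (RtoC t))))))).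

Definition u1_partial om ze C D R_ r (n0 N : nat) (t : R) : Cpx :=
  CsumN (fun k => u1_term om ze C D R_ r (n0 + k) t) N.
Definition u2_partial om ze C D c d (n0 N : nat) (t : R) : Cpx :=
  CsumN (fun k => u2_term om ze C D c d (n0 + k) t) N.

Definition RInt_eq (f : R -> R) (a b I : R) : Prop :=
  exists pr : Riemann_integrable f a b, RiemannInt pr = I.

(* Main.v *)
(** Both signals are real, and the square of a sum of modes [2 Re (C_n e^{i om_n t})]
  integrates against [sin (PI t / T)] to a Hermitian form whose entries are explicit.
  The diagonal is [2 Kd |C_n|^2 (1 + e^{-2 Im om_n T})], where
  [Kd = (PI/T) / (4 (Im om_n)^2 + (PI/T)^2)]; with a real gap at least [g] and
  [g T >= 2 PI], the off-diagonal entries are at most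
  [(4 (PI/T) / g^2) / (4 (n - m)^2 - 1)] up to the weights, and a Schur test together with
  [sum_{j >= 1} 1/(4 j^2 - 1) = 1/2] bounds their total by [4 (PI/T) / g^2].
  With [g^2 = gam^2 (1 - eps/2)] the condition on [T] gives
  [4 (PI/T) / g^2 <= rho Kd], [rho = (1 - eps) / (1 - eps/2) < 1], uniformly in [T], so every
  such form is comparable to its diagonal.  In [u_1] and [u_2] the remaining parts (the
  [D_n] in [u_1], the [c_n C_n] in [u_2] and the real exponentials) are small multiples of the
  same diagonals once [n_0] is large, again uniformly in [T]: for the real exponentials because
  [int sin (PI t / T) e^{-2xt} dt = O(1/T)] while [Kd] is at least of order [1/T].
  Applied to truncated coefficients, the upper bound makes the partial integrals Cauchy. *)

From Coquelicot Require Import Rcomplements Hierarchy Continuity Derive RInt RInt_analysis AutoDerive.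
Require Import Defs.
From Stdlib Require Import Reals.
From Stdlib Require Import Arith Lra Lia.
Open Scope R_scope.

(** * Integration against the sine weight *)


Definition cont (f : R -> R) : Prop := forall t, continuous f t.

(** On [[0, T]] the weight [kweight] is this sine. Using the sine itself keeps the integrand
    continuous on the whole line; [RInt_eq_wint] goes back to [kweight]. *)
Definition wint (T : R) (f : R -> R) : R :=
  RInt (fun t => sin (PI * t / T) * f t) 0 T.

Lemma cont_const (c : R) : cont (fun _ => c).
Proof. intros t. apply continuous_const. Qed.

Lemma cont_plus (f g : R -> R) : cont f -> cont g -> cont (fun t => f t + g t).
Proof. intros Hf Hg t. apply (continuous_plus f g); auto. Qed.

Lemma cont_mult (f g : R -> R) : cont f -> cont g -> cont (fun t => f t * g t).
Proof. intros Hf Hg t. apply (continuous_mult f g); auto. Qed.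

Lemma cont_ex_derive (f : R -> R) : (forall t, ex_derive f t) -> cont f.
Proof. intros H t. apply (ex_derive_continuous f); auto. Qed.

Lemma cont_sum (f : nat -> R -> R) (N : nat) :
  (forall k, cont (f k)) -> cont (fun t => sum_f_R0 (fun k => f k t) N).
Proof.
  intros H; induction N as [|N IH]; simpl; [apply H | apply cont_plus; auto].
Qed.

Lemma weight_cont (T : R) (f : R -> R) :
  cont f -> cont (fun t => sin (PI * t / T) * f t).
Proof.
  intros Hf. apply cont_mult; auto. apply cont_ex_derive.
  intros t. auto_derive. exact I.
Qed.

Lemma cont_ex_RInt (f : R -> R) (a b : R) : cont f -> ex_RInt f a b.
Proof. intros Hf. apply (ex_RInt_continuous f). intros; apply Hf. Qed.

Lemma wint_ext (T : R) (f g : R -> R) : (forall t, f t = g t) -> wint T f = wint T g.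
Proof.
  intros H. unfold wint. apply RInt_ext. intros x _. simpl. now rewrite H.
Qed.

Lemma wint_plus (T : R) (f g : R -> R) : cont f -> cont g ->
  wint T (fun t => f t + g t) = wint T f + wint T g.
Proof.
  intros Hf Hg. unfold wint.
  rewrite <- (RInt_plus (V := R_CompleteNormedModule)
    (fun t => sin (PI * t / T) * f t) (fun t => sin (PI * t / T) * g t));
    try (apply cont_ex_RInt, weight_cont; assumption).
  apply RInt_ext. intros x _. unfold plus; simpl; ring.
Qed.

Lemma wint_scal (T c : R) (f : R -> R) : cont f ->
  wint T (fun t => c * f t) = c * wint T f.
Proof.
  intros Hf. unfold wint.
  transitivity (RInt (fun t => scal c (sin (PI * t / T) * f t)) 0 T).
  - apply RInt_ext. intros x _. unfold scal; simpl; unfold mult; simpl; ring.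
  - apply (RInt_scal (V := R_CompleteNormedModule)).
    now apply cont_ex_RInt, weight_cont.
Qed.

Lemma wint_sum (T : R) (f : nat -> R -> R) (N : nat) : (forall k, cont (f k)) ->
  wint T (fun t => sum_f_R0 (fun k => f k t) N) = sum_f_R0 (fun k => wint T (f k)) N.
Proof.
  intros H; induction N as [|N IH]; simpl; [reflexivity|].
  rewrite wint_plus; auto using cont_sum. now rewrite IH.
Qed.

Lemma weight_nonneg (T t : R) : 0 < T -> 0 <= t <= T -> 0 <= sin (PI * t / T).
Proof.
  intros HT Ht. pose proof PI_RGT_0.
  apply sin_ge_0.
  - apply Rmult_le_pos; [nra | left; now apply Rinv_0_lt_compat].
  - apply Rmult_le_reg_r with T; [assumption|]. field_simplify; [nra | lra].
Qed.

Lemma wint_le (T : R) (f g : R -> R) : 0 < T -> cont f -> cont g ->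
  (forall t, 0 <= t -> f t <= g t) -> wint T f <= wint T g.
Proof.
  intros HT Hf Hg H. unfold wint.
  apply RInt_le; [lra | apply cont_ex_RInt, weight_cont; assumption
                 | apply cont_ex_RInt, weight_cont; assumption |].
  intros t Ht. apply Rmult_le_compat_l; [apply weight_nonneg; lra | apply H; lra].
Qed.

(* [osc p q s tau t = Re ((p + i q) e^{(s + i tau) t})] *)
Definition osc (p q s tau t : R) : R :=
  exp (s * t) * (p * cos (tau * t) - q * sin (tau * t)).

Lemma osc_cont (p q s tau : R) : cont (osc p q s tau).
Proof. apply cont_ex_derive. intros t. unfold osc. auto_derive. exact I. Qed.

(* With [A (lambda^2 + b^2) = p + i q], [b = PI / T], the function
   [Re (A (lambda sin (b t) - b cos (b t)) e^{lambda t})] is an antiderivative. *)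
Lemma wint_osc_antiderivative (T p q s tau : R) : 0 < T ->
  wint T (osc (p * (s^2 - tau^2 + (PI/T)^2) - q * (2*s*tau))
              (p * (2*s*tau) + q * (s^2 - tau^2 + (PI/T)^2)) s tau)
  = PI / T * (osc p q s tau T + p).
Proof.
  intros HT. unfold wint. apply is_RInt_unique.
  set (b := PI / T).
  set (G := fun t => exp (s*t) * (
     (p * s - q * tau) * sin (b*t) * cos (tau*t)
     - (p * tau + q * s) * sin (b*t) * sin (tau*t)
     - b * cos (b*t) * (p * cos (tau*t) - q * sin (tau*t)))).
  assert (HG : is_RInt (fun t => sin (PI * t / T) *
     osc (p * (s^2 - tau^2 + b^2) - q * (2*s*tau))
              (p * (2*s*tau) + q * (s^2 - tau^2 + b^2)) s tau t) 0 T
     (minus (G T) (G 0))).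
  { apply (is_RInt_derive (V := R_CompleteNormedModule)) with (f := G).
    - intros x _. replace (PI * x / T) with (b * x) by (unfold b; field; lra).
      unfold G, osc. auto_derive; [exact I|]. ring.
    - intros x _. apply weight_cont, osc_cont. }
  (* At both endpoints [sin (b t)] vanishes, while [cos (b t)] goes from [1] to [-1], so the two
     boundary values add up. *)
  replace (b * (osc p q s tau T + p)) with (minus (G T) (G 0)); [exact HG|].
  unfold minus, plus, opp; simpl. unfold G, osc.
  replace (b * T) with PI by (unfold b; field; lra).
  rewrite !Rmult_0_r, sin_PI, cos_PI, exp_0, sin_0, cos_0. fold b. ring.
Qed.

(** A real part is at most the modulus; the defect of the squares is [(p sin + q cos)^2]. *)
Lemma osc_bound (p q s tau t : R) : Rabs (osc p q s tau t) <= exp (s*t) * sqrt (p^2 + q^2).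
Proof.
  unfold osc. rewrite Rabs_mult, (Rabs_right (exp _)) by (left; apply exp_pos).
  apply Rmult_le_compat_l; [left; apply exp_pos|].
  rewrite <- sqrt_Rsqr_abs. apply sqrt_le_1_alt. unfold Rsqr.
  pose proof (sin2_cos2 (tau*t)) as H. unfold Rsqr in H.
  pose proof (Rle_0_sqr (p * sin (tau*t) + q * cos (tau*t))) as H1. unfold Rsqr in H1.
  assert (E : p^2 + q^2 = (p^2 + q^2) * (sin (tau * t) * sin (tau * t) + cos (tau * t) * cos (tau * t)))
    by (rewrite H; ring).
  rewrite E. nra.
Qed.

(** With [lambda = s + i tau], divide [p + i q] by [lambda^2 + b^2] and apply the antiderivative.
    The divisor has modulus at least [tau^2 - b^2], whatever [s] is. *)
Lemma wint_osc_bound (T p q s tau : R) : 0 < T -> (PI / T)^2 < tau^2 ->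
  Rabs (wint T (osc p q s tau))
  <= PI / T * (1 + exp (s * T)) / (tau^2 - (PI/T)^2) * sqrt (p^2 + q^2).
Proof.
  intros HT Htau.
  set (b := PI / T) in *.
  assert (Hb : 0 < b) by (apply Rdiv_lt_0_compat; [apply PI_RGT_0 | assumption]).
  set (X := s^2 - tau^2 + b^2). set (Y := 2*s*tau).
  set (d := tau^2 - b^2). assert (Hd : 0 < d) by (unfold d; lra).
  (* [X + i Y] is [lambda^2 + b^2]. *)
  assert (HXY : d^2 <= X^2 + Y^2).
  { replace (X^2 + Y^2) with (d^2 + s^2 * (s^2 + 2 * tau^2 + 2 * b^2)) by (unfold X, Y, d; ring).
    pose proof (pow2_ge_0 s). pose proof (pow2_ge_0 tau). pose proof (pow2_ge_0 b). nra. }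
  assert (Hd2 : 0 < d^2) by nra.
  assert (Hp : 0 < X^2 + Y^2) by lra.
  (* [p' + i q'] is the quotient of [p + i q] by [X + i Y]. *)
  set (p' := (p * X + q * Y) / (X^2 + Y^2)). set (q' := (q * X - p * Y) / (X^2 + Y^2)).
  pose proof (wint_osc_antiderivative T p' q' s tau HT) as H.
  fold b X Y in H.
  replace (p' * X - q' * Y) with p in H by (unfold p', q'; field; lra).
  replace (p' * Y + q' * X) with q in H by (unfold p', q'; field; lra).
  rewrite H, Rabs_mult, (Rabs_right b) by lra.
  assert (Hn : sqrt (p'^2 + q'^2) <= sqrt (p^2 + q^2) / d).
  { assert (E : sqrt (p^2 + q^2) / d = sqrt ((p^2 + q^2) / d^2)).
    { rewrite sqrt_div_alt by assumption. f_equal. symmetry. apply sqrt_pow2. lra. }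
    rewrite E. apply sqrt_le_1_alt.
    replace (p'^2 + q'^2) with ((p^2 + q^2) / (X^2 + Y^2)) by (unfold p', q'; field; lra).
    apply Rmult_le_compat_l; [pose proof (pow2_ge_0 p); pose proof (pow2_ge_0 q); lra|].
    apply Rinv_le_contravar; assumption. }
  assert (Hpp : Rabs p' <= sqrt (p'^2 + q'^2)).
  { rewrite <- sqrt_Rsqr_abs. apply sqrt_le_1_alt. unfold Rsqr.
    pose proof (pow2_ge_0 q'). nra. }
  pose proof (osc_bound p' q' s tau T) as Ho.
  pose proof (exp_pos (s*T)).
  replace (b * (1 + exp (s * T)) / d * sqrt (p ^ 2 + q ^ 2))
    with (b * ((1 + exp (s*T)) * (sqrt (p^2 + q^2) / d))) by (field; lra).
  apply Rmult_le_compat_l; [lra|].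
  eapply Rle_trans; [apply Rabs_triang|].
  apply Rle_trans with ((1 + exp (s*T)) * sqrt (p'^2 + q'^2)); [lra|].
  apply Rmult_le_compat_l; lra.
Qed.

Definition Kd (T beta : R) : R := PI / T / (4 * beta^2 + (PI/T)^2).

Lemma wint_osc_real (T p beta : R) : 0 < T ->
  wint T (osc p 0 (- (beta + beta)) 0) = Kd T beta * (1 + exp (-2 * beta * T)) * p.
Proof.
  intros HT. unfold Kd. set (b := PI/T).
  assert (Hb : 0 < b) by (apply Rdiv_lt_0_compat; [apply PI_RGT_0 | assumption]).
  assert (Hp : 0 < 4 * beta^2 + b^2) by (pose proof (pow2_ge_0 beta); nra).
  pose proof (wint_osc_antiderivative T (p / (4 * beta^2 + b^2)) 0 (- (beta + beta)) 0 HT) as H.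
  fold b in H.
  replace (p / (4 * beta ^ 2 + b ^ 2) * ((- (beta + beta)) ^ 2 - 0 ^ 2 + b ^ 2) -
         0 * (2 * (- (beta + beta)) * 0)) with p in H by (field; lra).
  replace (p / (4 * beta ^ 2 + b ^ 2) * (2 * (- (beta + beta)) * 0) +
         0 * ((- (beta + beta)) ^ 2 - 0 ^ 2 + b ^ 2)) with 0 in H by ring.
  rewrite H. unfold osc. rewrite !Rmult_0_l, cos_0.
  replace (- (beta + beta) * T) with (-2 * beta * T) by ring. field. lra.
Qed.

(** For complex [z], [w]: [(2 Re z)(2 Re w) = 2 Re (z conj w) + 2 Re (z w)]. The first term carries
    the difference of the frequencies, the second their sum. *)
Lemma osc_mult (p q s a p' q' s' a' t : R) :
  (2 * osc p q s a t) * (2 * osc p' q' s' a' t)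
  = 2 * osc (p*p' + q*q') (q*p' - p*q') (s + s') (a - a') t
  + 2 * osc (p*p' - q*q') (p*q' + q*p') (s + s') (a + a') t.
Proof.
  unfold osc.
  replace ((s + s') * t) with (s*t + s'*t) by ring.
  replace ((a - a') * t) with (a*t - a'*t) by ring.
  replace ((a + a') * t) with (a*t + a'*t) by ring.
  rewrite exp_plus, cos_minus, cos_plus, sin_minus, sin_plus. ring.
Qed.

(** * Finite double sums and the Schur test *)

Lemma sum_sum_swap (f : nat -> nat -> R) (N M : nat) :
  sum_f_R0 (fun i => sum_f_R0 (fun j => f i j) M) N
  = sum_f_R0 (fun j => sum_f_R0 (fun i => f i j) N) M.
Proof.
  induction N as [|N IH]; simpl; [reflexivity|].
  rewrite IH. now rewrite <- plus_sum.
Qed.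

Lemma sum_sqr (f : nat -> R) (N : nat) :
  (sum_f_R0 f N)^2 = sum_f_R0 (fun i => sum_f_R0 (fun j => f i * f j) N) N.
Proof.
  simpl. rewrite Rmult_1_r. rewrite scal_sum.
  apply sum_eq; intros i _. rewrite scal_sum. apply sum_eq; intros; ring.
Qed.

Lemma sum_nonneg (f : nat -> R) (N : nat) :
  (forall k, (k <= N)%nat -> 0 <= f k) -> 0 <= sum_f_R0 f N.
Proof.
  intros H. induction N as [|N IH]; simpl; [now apply H|].
  apply Rplus_le_le_0_compat; [apply IH; auto | apply H; auto].
Qed.

Lemma sum_scal (c : R) (f : nat -> R) (N : nat) :
  sum_f_R0 (fun k => c * f k) N = c * sum_f_R0 f N.
Proof. rewrite scal_sum. apply sum_eq; intros; ring. Qed.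

(** Bound [x i * x j] by half the sum of the squares; by the symmetry of [h] both halves become row
    sums. *)
Lemma schur (h : nat -> nat -> R) (x : nat -> R) (H : R) (N : nat) :
  (forall i j, h i j = h j i) ->
  (forall i j, 0 <= h i j) ->
  (forall i, (i <= N)%nat -> sum_f_R0 (h i) N <= H) ->
  sum_f_R0 (fun i => sum_f_R0 (fun j => x i * x j * h i j) N) N
  <= H * sum_f_R0 (fun i => x i ^ 2) N.
Proof.
  intros Hsym Hpos Hrow.
  apply Rle_trans with (sum_f_R0 (fun i => sum_f_R0 (fun j =>
     /2 * (x i ^2 * h i j) + /2 * (x j ^2 * h j i)) N) N).
  - apply sum_Rle; intros i _. apply sum_Rle; intros j _.
    rewrite (Hsym j i). specialize (Hpos i j).
    pose proof (pow2_ge_0 (x i - x j)). nra.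
  - assert (E : sum_f_R0 (fun i => sum_f_R0 (fun j =>
       /2 * (x i ^2 * h i j) + /2 * (x j ^2 * h j i)) N) N
       = sum_f_R0 (fun i => sum_f_R0 (h i) N * x i ^ 2) N).
    { transitivity (/2 * sum_f_R0 (fun i => sum_f_R0 (fun j => x i ^2 * h i j) N) N
        + /2 * sum_f_R0 (fun i => sum_f_R0 (fun j => x j ^2 * h j i) N) N).
      - rewrite <- !sum_scal, <- plus_sum. apply sum_eq; intros i _.
        rewrite <- !sum_scal, <- plus_sum. reflexivity.
      - rewrite (sum_sum_swap (fun i j => x j ^2 * h j i)).
        rewrite <- Rmult_plus_distr_r.
        replace (/2 + /2) with 1 by field. rewrite Rmult_1_l.
        apply sum_eq; intros i _. rewrite sum_scal. ring. }
    rewrite E, <- sum_scal. apply sum_Rle; intros i Hi.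
    apply Rmult_le_compat_r; [apply pow2_ge_0 | auto].
Qed.

(** * Row sums of the kernels for difference and sum frequencies *)

Lemma INR_diff_sqr_ge_1 (i j : nat) : i <> j -> 1 <= (INR i - INR j)^2.
Proof.
  intros Hij.
  assert (1 <= INR i - INR j \/ 1 <= INR j - INR i) as [H|H]; [|nra|nra].
  destruct (Nat.lt_gt_cases i j) as [[H|H] _]; [assumption|right|left];
    apply le_INR in H; rewrite S_INR in H; lra.
Qed.

(** Kernel of the difference frequencies. It is zero on the diagonal because those entries of the
    form are computed exactly. *)
Definition kap (i j : nat) : R :=
  if Nat.eq_dec i j then 0 else / (4 * (INR i - INR j)^2 - 1).

Lemma kap_nonneg (i j : nat) : 0 <= kap i j.
Proof.
  unfold kap. destruct (Nat.eq_dec i j) as [|n]; [lra|].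
  left; apply Rinv_0_lt_compat. pose proof (INR_diff_sqr_ge_1 i j n). lra.
Qed.

Lemma kap_sym (i j : nat) : kap i j = kap j i.
Proof.
  unfold kap. destruct (Nat.eq_dec i j), (Nat.eq_dec j i); try congruence.
  f_equal; ring.
Qed.

(** An odd integer is not zero; these are the denominators of the telescoping sum. *)
Lemma odd_diff_nonzero (i j : nat) : 2 * (INR j - INR i) - 1 <> 0.
Proof.
  destruct (le_lt_dec j i) as [H|H]; apply le_INR in H; rewrite ?S_INR in H; lra.
Qed.

(* [1/(4x^2-1) = (1/(2x-1) - 1/(2x+1))/2] telescopes; at [x = 0] it is [-1],
   which is what has to be added back to reach [kap]. *)
Lemma kap_row_partial (i N : nat) :
  sum_f_R0 (kap i) N
  = (if le_dec i N then 1 else 0)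
    - / 2 * (/ (2 * INR i + 1) + / (2 * (INR (S N) - INR i) - 1)).
Proof.
  assert (Hi := pos_INR i).
  induction N as [|N IH].
  - simpl sum_f_R0. unfold kap. rewrite S_INR.
    assert (H1 := odd_diff_nonzero i 1). simpl (INR 1) in H1. simpl (INR 0).
    destruct (Nat.eq_dec i 0) as [->|n].
    + destruct (le_dec 0 0); [simpl; field | lia].
    + destruct (le_dec i 0); [lia|].
      assert (1 <= INR i) by (apply (le_INR 1); lia).
      field. repeat split; try lra. nra.
  - simpl sum_f_R0. rewrite IH. unfold kap.
    assert (H1 := odd_diff_nonzero i (S N)). assert (H2 := odd_diff_nonzero i (S (S N))).
    rewrite (S_INR (S N)) in *.
    destruct (Nat.eq_dec i (S N)) as [->|n].
    + destruct (le_dec (S N) N); [lia|]. destruct (le_dec (S N) (S N)); [|lia].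
      replace (2 * (INR (S N) - INR (S N)) - 1) with (-1) by ring.
      replace (2 * (INR (S N) + 1 - INR (S N)) - 1) with 1 by ring. field. lra.
    + assert (Hs := INR_diff_sqr_ge_1 i (S N) n).
      replace (if le_dec i (S N) then 1 else 0) with (if le_dec i N then 1 else 0)
        by (destruct (le_dec i N), (le_dec i (S N)); try lia; reflexivity).
      destruct (le_dec i N); field; repeat split; lra.
Qed.

Lemma kap_row (i N : nat) : (i <= N)%nat -> sum_f_R0 (kap i) N <= 1.
Proof.
  intros Hi. rewrite kap_row_partial. destruct (le_dec i N); [|lia].
  assert (0 <= INR i) by apply pos_INR.
  assert (INR i <= INR N) by now apply le_INR.
  rewrite S_INR.
  assert (0 < / (2 * INR i + 1)) by (apply Rinv_0_lt_compat; lra).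
  assert (0 < / (2 * (INR N + 1 - INR i) - 1)) by (apply Rinv_0_lt_compat; lra).
  lra.
Qed.

(** Kernel of the sum frequencies: if the first frequency is at least [g P] and the gaps are at
    least [g], then [a i + a j >= g (2 P + i + j)]. *)
Definition kap_sum (P i j : nat) : R := / (4 * (2 * INR P + INR i + INR j)^2 - 1).

(** The same telescoping, now without a singular term. A large [P], that is a large first frequency,
    makes this contribution as small as desired. *)
Lemma kap_sum_row (P i N : nat) : (1 <= P)%nat -> sum_f_R0 (kap_sum P i) N <= / INR P.
Proof.
  intros HP. assert (1 <= INR P) by (apply (le_INR 1); lia).
  assert (0 <= INR i) by apply pos_INR.
  assert (E : sum_f_R0 (kap_sum P i) N = / 2 * (/ (2 * (2 * INR P + INR i) - 1)
     - / (2 * (2 * INR P + INR i + INR N) + 1))).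
  { induction N as [|N IH].
    - simpl. unfold kap_sum. simpl. field. repeat split; nra.
    - simpl sum_f_R0. rewrite IH. unfold kap_sum. rewrite S_INR.
      assert (0 <= INR N) by apply pos_INR. field. repeat split; nra. }
  rewrite E. assert (0 <= INR N) by apply pos_INR.
  assert (0 < / (2 * (2 * INR P + INR i + INR N) + 1)) by (apply Rinv_0_lt_compat; lra).
  assert (/ (2 * (2 * INR P + INR i) - 1) <= / INR P) by (apply Rinv_le_contravar; lra).
  assert (0 < / INR P) by (apply Rinv_0_lt_compat; lra). lra.
Qed.

(** * The quadratic form of a sum of modes *)

Definition wgt (T beta : R) : R := 1 + exp (-2 * beta * T).

Lemma wgt_ge_1 (T beta : R) : 1 <= wgt T beta.
Proof. unfold wgt. pose proof (exp_pos (-2 * beta * T)). lra. Qed.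

(** This is [C e^{i om t}] plus its conjugate, for [C = p + i q] and [om = a + i beta]. *)
Definition mode (p q beta a t : R) : R := 2 * osc p q (- beta) a t.

Lemma mode_cont (p q beta a : R) : cont (mode p q beta a).
Proof. apply cont_mult; [apply cont_const | apply osc_cont]. Qed.

(** Serves difference and sum frequencies alike: [m] is the index distance [i - j] or [2 P + i + j],
    and [r + i u] is the product of the two coefficients, one possibly conjugated, so only its
    modulus enters. *)
Lemma wint_osc_pair (T g m p q p' q' r u beta beta' tau : R) :
  0 < T -> 0 < g -> 2 * PI <= g * T -> 1 <= m^2 -> g^2 * m^2 <= tau^2 ->
  r^2 + u^2 = (p^2 + q^2) * (p'^2 + q'^2) ->
  Rabs (wint T (osc r u (- beta + - beta') tau))
  <= sqrt (wgt T beta * (p^2 + q^2)) * sqrt (wgt T beta' * (p'^2 + q'^2))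
     * (4 * (PI / T) / g^2 * / (4 * m^2 - 1)).
Proof.
  intros HT Hg HgT Hm Htau Hru.
  set (b := PI / T).
  assert (Hb : 0 < b) by (apply Rdiv_lt_0_compat; [apply PI_RGT_0 | assumption]).
  assert (Hbg : 2 * b <= g).
  { apply Rmult_le_reg_r with T; [assumption|].
    replace (2 * b * T) with (2 * PI) by (unfold b; field; lra). assumption. }
  assert (Hbg2 : 4 * b^2 <= g^2) by nra.
  assert (Hg2 : 0 < g^2) by nra.
  assert (Hbt : b^2 < tau^2) by nra.
  eapply Rle_trans; [now apply wint_osc_bound|]. fold b.
  rewrite Hru, sqrt_mult_alt by (pose proof (pow2_ge_0 p); pose proof (pow2_ge_0 q); lra).
  pose proof (wgt_ge_1 T beta). pose proof (wgt_ge_1 T beta').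
  rewrite !sqrt_mult_alt by lra.
  set (x := sqrt (p^2 + q^2)). set (y := sqrt (p'^2 + q'^2)).
  assert (0 <= x) by apply sqrt_pos. assert (0 <= y) by apply sqrt_pos.
  (* Cauchy-Schwarz for the vectors [(1, e^{- beta T})] and [(1, e^{- beta' T})]. *)
  assert (Hw : 1 + exp ((- beta + - beta') * T) <= sqrt (wgt T beta) * sqrt (wgt T beta')).
  { rewrite <- sqrt_mult_alt by lra.
    rewrite <- (sqrt_pow2 (1 + exp ((- beta + - beta') * T)))
      by (pose proof (exp_pos ((- beta + - beta') * T)); lra).
    apply sqrt_le_1_alt. unfold wgt.
    replace ((- beta + - beta') * T) with (- beta * T + - beta' * T) by ring.
    replace (-2 * beta * T) with (- beta * T + - beta * T) by ring.
    replace (-2 * beta' * T) with (- beta' * T + - beta' * T) by ring.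
    rewrite !exp_plus. pose proof (pow2_ge_0 (exp (- beta * T) - exp (- beta' * T))). nra. }
  (* Since [b <= g / 2], [tau^2 - b^2] is at least [g^2 (m^2 - 1/4)]. *)
  assert (Hk : b * / (tau^2 - b^2) <= 4 * b / g^2 * / (4 * m^2 - 1)).
  { replace (4 * b / g^2 * / (4 * m^2 - 1)) with (b * / (g^2 / 4 * (4 * m^2 - 1)))
      by (field; repeat split; lra).
    apply Rmult_le_compat_l; [lra|]. apply Rinv_le_contravar; nra. }
  assert (0 <= b * / (tau^2 - b^2)).
  { apply Rmult_le_pos; [lra|]. left; apply Rinv_0_lt_compat; lra. }
  assert (0 <= x * y) by now apply Rmult_le_pos.
  set (e := 1 + exp ((- beta + - beta') * T)) in *.
  assert (0 < e) by (unfold e; pose proof (exp_pos ((- beta + - beta') * T)); lra).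
  replace (b * e / (tau^2 - b^2) * (x * y)) with (x * y * e * (b * / (tau^2 - b^2)))
    by (field; lra).
  replace (sqrt (wgt T beta) * x * (sqrt (wgt T beta') * y))
    with (x * y * (sqrt (wgt T beta) * sqrt (wgt T beta'))) by ring.
  apply Rmult_le_compat; auto.
  - apply Rmult_le_pos; lra.
  - now apply Rmult_le_compat_l.
Qed.

Definition energy (T : R) (beta p q : nat -> R) (N : nat) : R :=
  sum_f_R0 (fun k => Kd T (beta k) * (wgt T (beta k) * (p k ^ 2 + q k ^ 2))) N.

Lemma sum_delta (D : nat -> R) (N : nat) :
  sum_f_R0 (fun i => sum_f_R0 (fun j => if Nat.eq_dec i j then D i else 0) N) N
  = sum_f_R0 D N.
Proof.
  apply sum_eq; intros i Hi. revert Hi.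
  assert (H : forall M, sum_f_R0 (fun j => if Nat.eq_dec i j then D i else 0) M
     = if le_dec i M then D i else 0).
  { induction M as [|M IH]; simpl.
    - destruct (Nat.eq_dec i 0), (le_dec i 0); auto; lia.
    - rewrite IH. destruct (le_dec i M), (Nat.eq_dec i (S M)), (le_dec i (S M));
        try lia; ring. }
  intros Hi. rewrite H. destruct (le_dec i N); [reflexivity | lia].
Qed.

Lemma wint_mode_sum_sqr (T : R) (p q beta a : nat -> R) (N : nat) :
  wint T (fun t => (sum_f_R0 (fun k => mode (p k) (q k) (beta k) (a k) t) N)^2)
  = sum_f_R0 (fun i => sum_f_R0 (fun j =>
      wint T (fun t => mode (p i) (q i) (beta i) (a i) t
                       * mode (p j) (q j) (beta j) (a j) t)) N) N.
Proof.
  rewrite (wint_ext T _ (fun t => sum_f_R0 (fun i => sum_f_R0 (fun j =>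
      mode (p i) (q i) (beta i) (a i) t * mode (p j) (q j) (beta j) (a j) t) N) N))
    by (intros t; apply sum_sqr).
  rewrite (wint_sum T (fun i t => sum_f_R0 (fun j =>
      mode (p i) (q i) (beta i) (a i) t * mode (p j) (q j) (beta j) (a j) t) N)).
  - apply sum_eq; intros i _. apply wint_sum.
    intros j. apply cont_mult; apply mode_cont.
  - intros i. apply (cont_sum (fun j t =>
      mode (p i) (q i) (beta i) (a i) t * mode (p j) (q j) (beta j) (a j) t)).
    intros j. apply cont_mult; apply mode_cont.
Qed.

(** Expand the square. The zero-frequency terms give exactly [2 * energy]; all others are bounded by
    [wint_osc_pair] and summed by [schur]. In [1 + / INR P] the [1] comes from the difference
    frequencies and [/ INR P] from the sums. *)
Lemma ingham_mode (T g : R) (P : nat) (p q beta a : nat -> R) (N : nat) :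
  0 < T -> 0 < g -> 2 * PI <= g * T -> (1 <= P)%nat ->
  g * INR P <= a 0%nat -> (forall k, g <= a (S k) - a k) ->
  Rabs (wint T (fun t => (sum_f_R0 (fun k => mode (p k) (q k) (beta k) (a k) t) N)^2)
        - 2 * energy T beta p q N)
  <= 2 * (4 * (PI / T) / g^2 * (1 + / INR P))
     * sum_f_R0 (fun k => wgt T (beta k) * (p k ^ 2 + q k ^ 2)) N.
Proof.
  intros HT Hg HgT HP Ha0 Hgap.
  set (B := 4 * (PI / T) / g^2).
  assert (HB : 0 < B).
  { unfold B. apply Rdiv_lt_0_compat; [|nra].
    apply Rmult_lt_0_compat; [lra|]. apply Rdiv_lt_0_compat; [apply PI_RGT_0 | assumption]. }
  assert (Hmono : forall i k, g * INR k <= a (i + k)%nat - a i).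
  { intros i k; induction k as [|k IH].
    - rewrite Nat.add_0_r. simpl. lra.
    - rewrite S_INR, <- plus_n_Sm. specialize (Hgap (i + k)%nat). lra. }
  assert (Hdiff : forall i j, g^2 * (INR i - INR j)^2 <= (a i - a j)^2).
  { assert (Haux : forall i k, g^2 * (INR k)^2 <= (a (i + k)%nat - a i)^2).
    { intros i k. specialize (Hmono i k). assert (0 <= INR k) by apply pos_INR.
      rewrite <- Rpow_mult_distr. apply pow_incr.
    split; [apply Rmult_le_pos; lra | lra]. }
    intros i j. destruct (le_lt_dec i j) as [H|H].
    - replace j with (i + (j - i))%nat by lia. specialize (Haux i (j - i)%nat).
      rewrite plus_INR. replace ((INR i - (INR i + INR (j - i)))^2) with (INR (j - i) ^ 2) by ring.
      replace ((a i - a (i + (j - i))%nat)^2) with ((a (i + (j - i))%nat - a i)^2) by ring.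
      exact Haux.
    - replace i with (j + (i - j))%nat by lia. specialize (Haux j (i - j)%nat).
      rewrite plus_INR. replace ((INR j + INR (i - j) - INR j)^2) with (INR (i - j) ^ 2) by ring.
      exact Haux. }
  assert (HINRP : 1 <= INR P) by (apply (le_INR 1); lia).
  assert (Hsum : forall i j, g^2 * (2 * INR P + INR i + INR j)^2 <= (a i + a j)^2).
  { intros i j.
    pose proof (Hmono 0%nat i : g * INR i <= a i - a 0%nat).
    pose proof (Hmono 0%nat j : g * INR j <= a j - a 0%nat).
    assert (0 <= INR i) by apply pos_INR. assert (0 <= INR j) by apply pos_INR.
    rewrite <- Rpow_mult_distr. apply pow_incr.
    split; [apply Rmult_le_pos; lra | lra]. }
  (* The vector for the Schur test absorbs the weights, so that the kernel depends on the indices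
     alone. *)
  set (x := fun k => sqrt (wgt T (beta k) * (p k ^ 2 + q k ^ 2))).
  assert (Hx2 : forall k, x k ^ 2 = wgt T (beta k) * (p k ^ 2 + q k ^ 2)).
  { intros k. unfold x. rewrite pow2_sqrt; [reflexivity|].
    pose proof (wgt_ge_1 T (beta k)).
    apply Rmult_le_pos; [lra|]. pose proof (pow2_ge_0 (p k)); pose proof (pow2_ge_0 (q k)); lra. }
  set (h := fun i j => 2 * B * (kap i j + kap_sum P i j)).
  assert (Hks : forall i j, 0 < kap_sum P i j).
  { intros i j. unfold kap_sum. apply Rinv_0_lt_compat.
    assert (0 <= INR i) by apply pos_INR. assert (0 <= INR j) by apply pos_INR. nra. }
  assert (Hij : forall i j,
    Rabs (wint T (fun t => mode (p i) (q i) (beta i) (a i) t * mode (p j) (q j) (beta j) (a j) t)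
      - (if Nat.eq_dec i j
         then 2 * (Kd T (beta i) * (wgt T (beta i) * (p i ^ 2 + q i ^ 2))) else 0))
    <= x i * x j * h i j).
  { intros i j.
    rewrite (wint_ext T _ (fun t =>
       2 * osc (p i * p j + q i * q j) (q i * p j - p i * q j) (- beta i + - beta j) (a i - a j) t
       + 2 * osc (p i * p j - q i * q j) (p i * q j + q i * p j) (- beta i + - beta j) (a i + a j) t))
      by (intros t; apply osc_mult).
    rewrite wint_plus by (apply cont_mult; [apply cont_const | apply osc_cont]).
    rewrite !wint_scal by apply osc_cont.
    assert (H1 : Rabs (wint T (osc (p i * p j - q i * q j) (p i * q j + q i * p j)
        (- beta i + - beta j) (a i + a j))) <= x i * x j * (B * kap_sum P i j)).
    { apply wint_osc_pair; auto; [|ring].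
      assert (0 <= INR i) by apply pos_INR. assert (0 <= INR j) by apply pos_INR. nra. }
    unfold h, kap. destruct (Nat.eq_dec i j) as [->|n].
    (* On the diagonal the difference frequency is zero and cancels exactly; the term of frequency
       [2 a j] remains as an error. *)
    - replace (q j * p j - p j * q j) with 0 by ring.
      replace (a j - a j) with 0 by ring.
      replace (- beta j + - beta j) with (- (beta j + beta j)) in * by ring.
      rewrite wint_osc_real by assumption. unfold wgt at 1.
      match goal with |- Rabs ?u <= _ => match type of H1 with Rabs ?v <= _ =>
        replace u with (2 * v) by (unfold wgt; ring) end end.
      rewrite Rabs_mult, (Rabs_right 2) by lra. lra.
    - assert (H2 : Rabs (wint T (osc (p i * p j + q i * q j) (q i * p j - p i * q j)
        (- beta i + - beta j) (a i - a j))) <= x i * x j * (B * / (4 * (INR i - INR j)^2 - 1))).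
      { apply wint_osc_pair; auto using INR_diff_sqr_ge_1. ring. }
      rewrite Rminus_0_r, <- Rmult_plus_distr_l, Rabs_mult, (Rabs_right 2) by lra.
      eapply Rle_trans.
      + apply Rmult_le_compat_l; [lra | apply Rabs_triang].
      + lra. }
  rewrite wint_mode_sum_sqr. unfold energy. rewrite <- sum_scal.
  rewrite <- (sum_delta (fun k => 2 * (Kd T (beta k) * (wgt T (beta k) * (p k ^ 2 + q k ^ 2))))).
  rewrite <- minus_sum.
  eapply Rle_trans; [apply Rsum_abs|].
  eapply Rle_trans.
  { apply sum_Rle; intros i _. rewrite <- minus_sum.
    eapply Rle_trans; [apply Rsum_abs|]. apply sum_Rle; intros j _. apply Hij. }
  eapply Rle_trans.
  { apply (schur h x (2 * (B * (1 + / INR P)))).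
    - intros i j. unfold h, kap_sum. rewrite kap_sym. do 2 f_equal. f_equal. ring.
    - intros i j. unfold h. pose proof (kap_nonneg i j). specialize (Hks i j). nra.
    - intros i Hi. unfold h. rewrite sum_scal, plus_sum.
      pose proof (kap_row i N Hi). pose proof (kap_sum_row P i N HP). nra. }
  right. f_equal. apply sum_eq; intros k _. apply Hx2.
Qed.

Lemma PI_div_pos (T : R) : 0 < T -> 0 < PI / T.
Proof. intros HT. apply Rdiv_lt_0_compat; [apply PI_RGT_0 | assumption]. Qed.

Lemma Kd_pos (T beta : R) : 0 < T -> 0 < Kd T beta.
Proof.
  intros HT. pose proof (PI_div_pos T HT). unfold Kd.
  apply Rdiv_lt_0_compat; [assumption|]. pose proof (pow2_ge_0 beta). nra.
Qed.

Lemma energy_le (T eta : R) (beta p q p' q' : nat -> R) (N : nat) : 0 < T ->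
  (forall k, p k ^ 2 + q k ^ 2 <= eta * (p' k ^ 2 + q' k ^ 2)) ->
  energy T beta p q N <= eta * energy T beta p' q' N.
Proof.
  intros HT H. unfold energy. rewrite <- sum_scal. apply sum_Rle; intros k _.
  specialize (H k). pose proof (Kd_pos T (beta k) HT). pose proof (wgt_ge_1 T (beta k)).
  replace (eta * (Kd T (beta k) * (wgt T (beta k) * (p' k ^ 2 + q' k ^ 2))))
    with (Kd T (beta k) * (wgt T (beta k) * (eta * (p' k ^ 2 + q' k ^ 2)))) by ring.
  repeat (apply Rmult_le_compat_l; [lra|]). exact H.
Qed.

Lemma energy_nonneg (T : R) (beta p q : nat -> R) (N : nat) : 0 < T ->
  0 <= energy T beta p q N.
Proof.
  intros HT. apply sum_nonneg; intros k _.
  pose proof (Kd_pos T (beta k) HT). pose proof (wgt_ge_1 T (beta k)).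
  repeat (apply Rmult_le_pos; [lra|]).
  pose proof (pow2_ge_0 (p k)); pose proof (pow2_ge_0 (q k)); lra.
Qed.

Definition gap_const (T g : R) : R := 4 * (PI / T) / g^2.

Lemma gap_const_pos (T g : R) : 0 < T -> 0 < g -> 0 < gap_const T g.
Proof.
  intros HT Hg. pose proof (PI_div_pos T HT). unfold gap_const.
  apply Rdiv_lt_0_compat; [lra | nra].
Qed.

(** Comparing [gap_const] with [Kd] term by term turns the error of [ingham_mode] into at most
    [2 rho'] times the energy. The upper constant [4] comes from [rho' <= 1]. *)
Lemma mode_energy_bounds (T g rho rho' : R) (P : nat) (p q beta a : nat -> R) (N : nat) :
  0 < T -> 0 < g -> 2 * PI <= g * T -> (1 <= P)%nat ->
  g * INR P <= a 0%nat -> (forall k, g <= a (S k) - a k) ->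
  (forall k, gap_const T g <= rho * Kd T (beta k)) ->
  rho * (1 + / INR P) <= rho' -> rho' <= 1 ->
  let Q := wint T (fun t => (sum_f_R0 (fun k => mode (p k) (q k) (beta k) (a k) t) N)^2) in
  2 * (1 - rho') * energy T beta p q N <= Q <= 4 * energy T beta p q N.
Proof.
  intros HT Hg HgT HP Ha0 Hgap HB Hrho Hrho' Q.
  pose proof (ingham_mode T g P p q beta a N HT Hg HgT HP Ha0 Hgap) as H. fold Q in H.
  pose proof (energy_nonneg T beta p q N HT) as HE.
  assert (HP' : 0 < / INR P) by (apply Rinv_0_lt_compat, lt_0_INR; lia).
  assert (Hle : gap_const T g * (1 + / INR P)
     * sum_f_R0 (fun k => wgt T (beta k) * (p k ^ 2 + q k ^ 2)) N <= rho' * energy T beta p q N).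
  { unfold energy. rewrite <- !sum_scal. apply sum_Rle; intros k _.
    pose proof (wgt_ge_1 T (beta k)). pose proof (Kd_pos T (beta k) HT).
    replace (rho' * (Kd T (beta k) * (wgt T (beta k) * (p k ^ 2 + q k ^ 2))))
      with (rho' * Kd T (beta k) * (wgt T (beta k) * (p k ^ 2 + q k ^ 2))) by ring.
    apply Rmult_le_compat_r.
    - apply Rmult_le_pos; [lra|]. pose proof (pow2_ge_0 (p k)); pose proof (pow2_ge_0 (q k)); lra.
    - specialize (HB k). apply Rle_trans with (rho * Kd T (beta k) * (1 + / INR P)).
      + apply Rmult_le_compat_r; lra.
      + replace (rho * Kd T (beta k) * (1 + / INR P))
          with (rho * (1 + / INR P) * Kd T (beta k)) by ring.
        apply Rmult_le_compat_r; lra. }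
  unfold gap_const in Hle. apply Rabs_le_between in H.
  assert (rho' * energy T beta p q N <= 1 * energy T beta p q N) by (apply Rmult_le_compat_r; lra).
  lra.
Qed.

(** For [t >= 0] the sum is at most [e^{- x t}] times the sum of the [Rabs (R_ k)]; the square of
    this majorant integrates by [wint_osc_real]. *)
Lemma damped_sum_bound (T x : R) (R_ r : nat -> R) (N : nat) :
  0 < T -> 0 < x -> (forall k, r k <= - x) ->
  wint T (fun t => (sum_f_R0 (fun k => R_ k * exp (r k * t)) N)^2)
  <= PI / T / (2 * x^2) * (sum_f_R0 (fun k => Rabs (R_ k)) N)^2.
Proof.
  intros HT Hx Hr. set (A := sum_f_R0 (fun k => Rabs (R_ k)) N).
  pose proof (PI_div_pos T HT) as Hb.
  apply Rle_trans with (wint T (fun t => A^2 * osc 1 0 (- (x + x)) 0 t)).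
  - apply wint_le; [assumption | | apply cont_mult; [apply cont_const | apply osc_cont] |].
    + assert (Hc : cont (fun t => sum_f_R0 (fun k => R_ k * exp (r k * t)) N)).
      { apply (cont_sum (fun k t => R_ k * exp (r k * t))). intros k.
        apply cont_ex_derive. intros t. auto_derive. exact I. }
      intros t. apply (continuous_ext (fun t => sum_f_R0 (fun k => R_ k * exp (r k * t)) N
        * sum_f_R0 (fun k => R_ k * exp (r k * t)) N)).
      * intros u. simpl. ring.
      * apply cont_mult; assumption.
    + intros t Ht. unfold osc. rewrite Rmult_0_l, cos_0.
      replace (A^2 * (exp (- (x + x) * t) * (1 * 1 - 0 * sin 0)))
        with ((A * exp (- x * t))^2).
      2:{ replace (- (x + x) * t) with (- x * t + - x * t) by ring. rewrite exp_plus. ring. }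
      apply pow_maj_Rabs. unfold A.
      eapply Rle_trans; [apply Rsum_abs|].
      rewrite Rmult_comm, <- sum_scal. apply sum_Rle; intros k _.
      rewrite Rabs_mult, (Rabs_right (exp _)) by (left; apply exp_pos).
      rewrite Rmult_comm. apply Rmult_le_compat_r; [apply Rabs_pos|].
      destruct (Req_dec (r k * t) (- x * t)) as [->|Hn]; [lra|].
      left; apply exp_increasing. specialize (Hr k). nra.
  - rewrite wint_scal, wint_osc_real by (assumption || apply osc_cont).
    assert (HA : 0 <= A^2) by apply pow2_ge_0.
    rewrite (Rmult_comm (PI / T / _)). apply Rmult_le_compat_l; [assumption|].
    unfold Kd. set (b := PI / T) in *.
    assert (exp (-2 * x * T) <= 1).
    { rewrite <- exp_0. left; apply exp_increasing. nra. }
    assert (b / (4 * x^2 + b^2) <= b / (4 * x^2)).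
    { apply Rmult_le_compat_l; [lra|]. apply Rinv_le_contravar; nra. }
    assert (0 < b / (4 * x^2 + b^2)) by (apply Rdiv_lt_0_compat; nra).
    pose proof (exp_pos (-2 * x * T)).
    replace (b / (2 * x^2)) with (b / (4 * x^2) * 2) by (field; lra). nra.
Qed.

(** Lagrange's identity: twice the defect is the double sum of [(x i * y j - x j * y i)^2]. *)
Lemma sum_cauchy_schwarz (x y : nat -> R) (N : nat) :
  (sum_f_R0 (fun k => x k * y k) N)^2
  <= sum_f_R0 (fun k => x k ^ 2) N * sum_f_R0 (fun k => y k ^ 2) N.
Proof.
  assert (E : forall f h : nat -> R, sum_f_R0 f N * sum_f_R0 h N
    = sum_f_R0 (fun i => sum_f_R0 (fun j => f i * h j) N) N).
  { intros f h. rewrite Rmult_comm, scal_sum. apply sum_eq; intros i _.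
    now rewrite sum_scal. }
  apply Rmult_le_reg_l with 2; [lra|].
  replace (2 * (sum_f_R0 (fun k => x k ^ 2) N * sum_f_R0 (fun k => y k ^ 2) N))
    with (sum_f_R0 (fun k => x k ^ 2) N * sum_f_R0 (fun k => y k ^ 2) N
      + sum_f_R0 (fun k => y k ^ 2) N * sum_f_R0 (fun k => x k ^ 2) N) by ring.
  rewrite sum_sqr, !E, <- sum_scal, <- plus_sum. apply sum_Rle; intros i _.
  rewrite <- sum_scal, <- plus_sum. apply sum_Rle; intros j _.
  pose proof (pow2_ge_0 (x i * y j - x j * y i)). nra.
Qed.

(** * The signals and their energies *)

Definition modes (om C : nat -> Cpx) (N : nat) (t : R) : R :=
  sum_f_R0 (fun k => mode (re (C k)) (im (C k)) (im (om k)) (re (om k)) t) N.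

Definition damped (R_ r : nat -> R) (N : nat) (t : R) : R :=
  sum_f_R0 (fun k => R_ k * exp (r k * t)) N.

Definition cmul_seq (d D : nat -> Cpx) (k : nat) : Cpx := Cmul (d k) (D k).

Definition U1 (om ze C D : nat -> Cpx) (R_ r : nat -> R) (N : nat) (t : R) : R :=
  modes om C N t + damped R_ r N t + modes ze D N t.

Definition U2 (om ze C D c d : nat -> Cpx) (N : nat) (t : R) : R :=
  modes ze (cmul_seq d D) N t + modes om (cmul_seq c C) N t.

Definition cenergy (T : R) (om C : nat -> Cpx) (N : nat) : R :=
  energy T (fun k => im (om k)) (fun k => re (C k)) (fun k => im (C k)) N.

Lemma modes_cont (om C : nat -> Cpx) (N : nat) : cont (modes om C N).
Proof.
  apply (cont_sum (fun k => mode (re (C k)) (im (C k)) (im (om k)) (re (om k)))).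
  intros k; apply mode_cont.
Qed.

Lemma damped_cont (R_ r : nat -> R) (N : nat) : cont (damped R_ r N).
Proof.
  apply (cont_sum (fun k t => R_ k * exp (r k * t))). intros k.
  apply cont_ex_derive. intros t. auto_derive. exact I.
Qed.

Lemma cont_sqr (f : R -> R) : cont f -> cont (fun t => f t ^ 2).
Proof.
  intros Hf t. apply (continuous_ext (fun t => f t * f t)).
  - intros u. simpl. ring.
  - now apply cont_mult.
Qed.

Lemma U1_cont om ze C D R_ r N : cont (U1 om ze C D R_ r N).
Proof.
  apply cont_plus; [apply cont_plus|]; auto using modes_cont, damped_cont.
Qed.

Lemma U2_cont om ze C D c d N : cont (U2 om ze C D c d N).
Proof. apply cont_plus; apply modes_cont. Qed.

Lemma Cnorm2_sqr (z : Cpx) : Cnorm2 z = re z ^ 2 + im z ^ 2.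
Proof. unfold Cnorm2. ring. Qed.

Lemma Cnorm2_mul (z w : Cpx) : Cnorm2 (Cmul z w) = Cnorm2 z * Cnorm2 w.
Proof. unfold Cnorm2, Cmul; simpl. ring. Qed.

Lemma Cnorm2_nonneg (z : Cpx) : 0 <= Cnorm2 z.
Proof. rewrite Cnorm2_sqr. pose proof (pow2_ge_0 (re z)); pose proof (pow2_ge_0 (im z)); lra. Qed.

Definition mass (C d D : nat -> Cpx) (k : nat) : R :=
  Cnorm2 (C k) + Cnorm2 (cmul_seq d D k).

Lemma mass_nonneg C d D k : 0 <= mass C d D k.
Proof. unfold mass. pose proof (Cnorm2_nonneg (C k)). pose proof (Cnorm2_nonneg (cmul_seq d D k)). lra. Qed.

(** The modes of [C] in [U1] and of [d D] in [U2] dominate. The three remaining parts have integrals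
    of order [eta * E], and elementary inequalities between squares separate the five parts
    pointwise. *)
Lemma energy_bounds (T g rho rho' x eta mu V : R) (P : nat)
  (om ze c d : nat -> Cpx) (r v : nat -> R) :
  0 < T -> 0 < g -> 2 * PI <= g * T -> (1 <= P)%nat ->
  g * INR P <= re (om 0%nat) -> (forall k, g <= re (om (S k)) - re (om k)) ->
  g * INR P <= re (ze 0%nat) -> (forall k, g <= re (ze (S k)) - re (ze k)) ->
  (forall k, gap_const T g <= rho * Kd T (im (om k))) ->
  (forall k, gap_const T g <= rho * Kd T (im (ze k))) ->
  rho * (1 + / INR P) <= rho' -> 0 <= rho <= 1 -> 20 * eta <= 1 - rho' -> 0 < eta ->
  (forall k, Cnorm2 (c k) <= eta) -> (forall k, 1 <= eta * Cnorm2 (d k)) ->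
  0 < x -> (forall k, r k <= - x) ->
  0 < mu -> (forall N, sum_f_R0 (fun k => v k ^ 2) N <= V) ->
  PI / T / (2 * x^2) * (mu^2 * V) <= eta * gap_const T g ->
  forall (C D : nat -> Cpx) (R_ : nat -> R) (N : nat),
  (forall k, Rabs (R_ k) <= mu * v k * sqrt (mass C d D k)) ->
  let E := cenergy T om C N + cenergy T ze (cmul_seq d D) N in
  let Q := wint T (fun t => U1 om ze C D R_ r N t ^ 2 + U2 om ze C D c d N t ^ 2) in
  (1 - rho') / 2 * E <= Q <= 40 * E.
Proof.
  intros HT Hg HgT HP Hom0 Homg Hze0 Hzeg HBom HBze Hrho Hrho1 Heta Heta0 Hc Hd Hx Hr Hmu HV HRV
    C D R_ N HR E Q.
  assert (HbT := PI_div_pos T HT).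
  assert (HE1 := energy_nonneg T (fun k => im (om k)) (fun k => re (C k)) (fun k => im (C k)) N HT).
  assert (HE2 := energy_nonneg T (fun k => im (ze k)) (fun k => re (cmul_seq d D k))
    (fun k => im (cmul_seq d D k)) N HT).
  fold (cenergy T om C N) in HE1. fold (cenergy T ze (cmul_seq d D) N) in HE2.
  assert (HFom : forall Z, 2 * (1 - rho') * cenergy T om Z N
      <= wint T (fun t => modes om Z N t ^ 2) <= 4 * cenergy T om Z N).
  { intros Z. apply (mode_energy_bounds T g rho rho' P); auto. lra. }
  assert (HFze : forall Z, 2 * (1 - rho') * cenergy T ze Z N
      <= wint T (fun t => modes ze Z N t ^ 2) <= 4 * cenergy T ze Z N).
  { intros Z. apply (mode_energy_bounds T g rho rho' P); auto. lra. }
  assert (HcC : cenergy T om (cmul_seq c C) N <= eta * cenergy T om C N).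
  { apply energy_le; auto. intros k. rewrite <- !Cnorm2_sqr. unfold cmul_seq.
    rewrite Cnorm2_mul. apply Rmult_le_compat_r; [apply Cnorm2_nonneg | apply Hc]. }
  assert (HD : cenergy T ze D N <= eta * cenergy T ze (cmul_seq d D) N).
  { apply energy_le; auto. intros k. rewrite <- !Cnorm2_sqr. unfold cmul_seq.
    rewrite Cnorm2_mul, <- Rmult_assoc. rewrite <- (Rmult_1_l (Cnorm2 (D k))) at 1.
    apply Rmult_le_compat_r; [apply Cnorm2_nonneg | apply Hd]. }
  assert (HB := gap_const_pos T g HT Hg).
  assert (HBK : forall (w : nat -> Cpx) k, (forall k, gap_const T g <= rho * Kd T (im (w k))) ->
     gap_const T g <= Kd T (im (w k)) * wgt T (im (w k))).
  { intros w k Hw. specialize (Hw k). pose proof (Kd_pos T (im (w k)) HT).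
    pose proof (wgt_ge_1 T (im (w k))). nra. }
  (* Cauchy-Schwarz splits the bound on [R_] into the squares of [v], summing to at most [V], and
     the masses, which [gap_const] compares with the energy. *)
  assert (HRE : wint T (fun t => damped R_ r N t ^ 2) <= eta * E).
  { eapply Rle_trans; [now apply (damped_sum_bound T x)|].
    apply Rle_trans with (PI / T / (2 * x^2) *
      (mu^2 * V * sum_f_R0 (fun k => mass C d D k) N)).
    - apply Rmult_le_compat_l.
      { left; apply Rdiv_lt_0_compat; nra. }
      apply Rle_trans with ((sum_f_R0 (fun k => (mu * v k) * sqrt (mass C d D k)) N)^2).
      + apply pow_incr. split; [apply sum_nonneg; intros; apply Rabs_pos|].
        apply sum_Rle; intros; apply HR.
      + eapply Rle_trans; [apply sum_cauchy_schwarz|].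
        rewrite (sum_eq (fun k => sqrt (mass C d D k) ^ 2) (mass C d D))
          by (intros; apply pow2_sqrt, mass_nonneg).
        apply Rmult_le_compat_r; [apply sum_nonneg; intros; apply mass_nonneg|].
        rewrite (sum_eq _ (fun k => mu^2 * v k ^ 2)) by (intros; ring).
        rewrite sum_scal. apply Rmult_le_compat_l; [apply pow2_ge_0 | apply HV].
    - rewrite <- Rmult_assoc.
      eapply Rle_trans; [apply Rmult_le_compat_r; [|exact HRV]|].
      { apply sum_nonneg; intros; apply mass_nonneg. }
      rewrite Rmult_assoc. apply Rmult_le_compat_l; [lra|].
      unfold E, cenergy, energy. rewrite <- plus_sum, <- sum_scal.
      apply sum_Rle; intros k _. unfold mass. rewrite <- !Cnorm2_sqr.
      pose proof (HBK om k HBom). pose proof (HBK ze k HBze).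
      pose proof (Cnorm2_nonneg (C k)). pose proof (Cnorm2_nonneg (cmul_seq d D k)). nra. }
  pose proof (HFom C) as F1. pose proof (HFom (cmul_seq c C)) as F2.
  pose proof (HFze D) as F3. pose proof (HFze (cmul_seq d D)) as F4.
  assert (cR : cont (fun t => damped R_ r N t ^ 2)) by apply cont_sqr, damped_cont.
  assert (cm : forall w Z, cont (fun t => modes w Z N t ^ 2))
    by (intros; apply cont_sqr, modes_cont).
  assert (cQ : cont (fun t => U1 om ze C D R_ r N t ^ 2 + U2 om ze C D c d N t ^ 2)).
  { apply cont_plus; apply cont_sqr; [apply U1_cont | apply U2_cont]. }
  assert (cS : forall w z f, cont f -> cont (fun t => w * f t + z)).
  { intros. apply cont_plus; [apply cont_mult|]; auto using cont_const. }
  set (wC := wint T (fun t => modes om C N t ^ 2)) in *.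
  set (wcC := wint T (fun t => modes om (cmul_seq c C) N t ^ 2)) in *.
  set (wD := wint T (fun t => modes ze D N t ^ 2)) in *.
  set (wdD := wint T (fun t => modes ze (cmul_seq d D) N t ^ 2)) in *.
  set (wR := wint T (fun t => damped R_ r N t ^ 2)) in *.
  (* Both pointwise comparisons below are with a linear combination of the same five squares. *)
  assert (Hlin : forall k1 k2 k3 k4 k5,
    let f := fun t => k1 * modes om C N t ^ 2 + (k2 * damped R_ r N t ^ 2 +
       (k3 * modes ze D N t ^ 2 + (k4 * modes ze (cmul_seq d D) N t ^ 2
        + k5 * modes om (cmul_seq c C) N t ^ 2))) in
    cont f /\ wint T f = k1 * wC + (k2 * wR + (k3 * wD + (k4 * wdD + k5 * wcC)))).
  { intros k1 k2 k3 k4 k5.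
    assert (cK : forall k f, cont f -> cont (fun t => k * f t))
      by (intros; apply cont_mult; auto using cont_const).
    split.
    - repeat apply cont_plus; apply cK; auto.
    - rewrite !wint_plus, !wint_scal; auto; repeat apply cont_plus; apply cK; auto. }
  (* From [(a + b)^2 >= a^2 / 2 - b^2], with [a] the dominant part. *)
  assert (Hlow : /2 * wC + (-2 * wR + (-2 * wD + (/2 * wdD + -1 * wcC))) <= Q).
  { destruct (Hlin (/2) (-2) (-2) (/2) (-1)) as [cf <-].
    apply wint_le; auto. intros t _. unfold U1, U2.
    set (A1 := modes om C N t). set (A2 := damped R_ r N t). set (A3 := modes ze D N t).
    set (A4 := modes ze (cmul_seq d D) N t). set (A5 := modes om (cmul_seq c C) N t).
    pose proof (pow2_ge_0 (A1 + 2 * (A2 + A3))). pose proof (pow2_ge_0 (A2 - A3)).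
    pose proof (pow2_ge_0 (A4 + 2 * A5)). nra. }
  assert (Hup : Q <= 3 * wC + (3 * wR + (3 * wD + (2 * wdD + 2 * wcC)))).
  { destruct (Hlin 3 3 3 2 2) as [cf <-].
    apply wint_le; auto. intros t _. unfold U1, U2.
    set (A1 := modes om C N t). set (A2 := damped R_ r N t). set (A3 := modes ze D N t).
    set (A4 := modes ze (cmul_seq d D) N t). set (A5 := modes om (cmul_seq c C) N t).
    pose proof (pow2_ge_0 (A1 - A2)). pose proof (pow2_ge_0 (A2 - A3)).
    pose proof (pow2_ge_0 (A1 - A3)). pose proof (pow2_ge_0 (A4 - A5)). nra. }
  set (EC := cenergy T om C N) in *. set (EdD := cenergy T ze (cmul_seq d D) N) in *.
  assert (Hrp : 0 <= rho').
  { assert (0 < / INR P) by (apply Rinv_0_lt_compat, lt_0_INR; lia). nra. }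
  assert (eta * EC <= (1 - rho') / 20 * EC) by (apply Rmult_le_compat_r; lra).
  assert (eta * EdD <= (1 - rho') / 20 * EdD) by (apply Rmult_le_compat_r; lra).
  assert (0 <= rho' * EC) by (apply Rmult_le_pos; lra).
  assert (0 <= rho' * EdD) by (apply Rmult_le_pos; lra).
  assert (0 <= (1 - rho') * EC) by (apply Rmult_le_pos; lra).
  (* The dominant parts give at least [(1 - rho') E]. The losses are at most [6 eta] on [EC] and
     [2 eta + 8 eta] on [EdD], which is where [20 * eta <= 1 - rho'] comes from. *)
  unfold E in *. split; lra.
Qed.

Lemma exp_le (x y : R) : x <= y -> exp x <= exp y.
Proof. intros [H| ->]; [left; now apply exp_increasing | lra]. Qed.

(** * Passage to the limit *)

(** Write [a^2 - b^2 = (a - b)^2 + 2 (a - b) b] and use Young's inequality with parameter [eta]: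
    differences of the integrals are controlled by the integral of the squared difference plus [eta]
    times a bounded quantity. *)
Lemma form_cauchy (T A A' l : R) (u1 u2 : nat -> R -> R) (s : nat -> R) :
  0 < T -> (forall N, cont (u1 N)) -> (forall N, cont (u2 N)) -> 0 <= A -> 0 <= A' ->
  (forall M N, (M <= N)%nat ->
     wint T (fun t => (u1 N t - u1 M t)^2 + (u2 N t - u2 M t)^2) <= A * (s N - s M)) ->
  (forall N, wint T (fun t => u1 N t ^ 2 + u2 N t ^ 2) <= A') ->
  Un_cv s l ->
  exists I, Un_cv (fun N => wint T (fun t => u1 N t ^ 2 + u2 N t ^ 2)) I.
Proof.
  intros HT c1 c2 HA HA' Hd HQ Hs.
  set (Q := fun N => wint T (fun t => u1 N t ^ 2 + u2 N t ^ 2)).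
  assert (Hcv : forall M N eta, (M <= N)%nat -> 0 < eta ->
    Rabs (Q N - Q M) <= (1 + / eta) * (A * (s N - s M)) + eta * A').
  { intros M N eta HMN Heta.
    assert (cf : forall K, cont (fun t => u1 K t ^ 2 + u2 K t ^ 2))
      by (intros; apply cont_plus; apply cont_sqr; auto).
    assert (cm : forall u : nat -> R -> R, (forall K, cont (u K)) -> cont (fun t => u N t - u M t)).
    { intros u cu t. apply (continuous_minus (u N) (u M)); apply cu. }
    assert (cd : cont (fun t => (u1 N t - u1 M t)^2 + (u2 N t - u2 M t)^2))
      by (apply cont_plus; apply cont_sqr, cm; auto).
    assert (Hi : 0 < / eta) by now apply Rinv_0_lt_compat.
    assert (Hpt : forall t,
      Rabs ((u1 N t ^ 2 + u2 N t ^ 2) - (u1 M t ^ 2 + u2 M t ^ 2))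
      <= (1 + / eta) * ((u1 N t - u1 M t)^2 + (u2 N t - u2 M t)^2)
         + eta * (u1 M t ^ 2 + u2 M t ^ 2)).
    { intros t.
      assert (Hyoung : forall x y, Rabs (2 * (x * y)) <= / eta * x^2 + eta * y^2).
      { intros x y.
        assert (0 <= / eta * (x - eta * y)^2) by (apply Rmult_le_pos; [lra | apply pow2_ge_0]).
        assert (0 <= / eta * (x + eta * y)^2) by (apply Rmult_le_pos; [lra | apply pow2_ge_0]).
        replace (/ eta * (x - eta * y)^2) with (/ eta * x^2 + eta * y^2 - 2 * (x*y)) in * by (field; lra).
        replace (/ eta * (x + eta * y)^2) with (/ eta * x^2 + eta * y^2 + 2 * (x*y)) in * by (field; lra).
        apply Rabs_le; lra. }
      pose proof (Hyoung (u1 N t - u1 M t) (u1 M t)) as H1.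
      pose proof (Hyoung (u2 N t - u2 M t) (u2 M t)) as H2.
      apply Rabs_le_between in H1, H2.
      pose proof (pow2_ge_0 (u1 N t - u1 M t)). pose proof (pow2_ge_0 (u2 N t - u2 M t)).
      apply Rabs_le; lra. }
    assert (Hw : wint T (fun t => (1 + / eta) * ((u1 N t - u1 M t)^2 + (u2 N t - u2 M t)^2)
         + eta * (u1 M t ^ 2 + u2 M t ^ 2))
       <= (1 + / eta) * (A * (s N - s M)) + eta * A').
    { rewrite wint_plus by (apply cont_mult; auto using cont_const).
      rewrite !wint_scal by auto.
      apply Rplus_le_compat; apply Rmult_le_compat_l; auto; lra. }
    assert (cw : cont (fun t => (1 + / eta) * ((u1 N t - u1 M t)^2 + (u2 N t - u2 M t)^2)
         + eta * (u1 M t ^ 2 + u2 M t ^ 2)))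
      by (apply cont_plus; apply cont_mult; auto using cont_const).
    assert (Hab : forall K L, (forall t, u1 K t ^ 2 + u2 K t ^ 2 <= u1 L t ^ 2 + u2 L t ^ 2
        + ((1 + / eta) * ((u1 N t - u1 M t)^2 + (u2 N t - u2 M t)^2)
         + eta * (u1 M t ^ 2 + u2 M t ^ 2))) ->
        Q K <= Q L + ((1 + / eta) * (A * (s N - s M)) + eta * A')).
    { intros K L HKL. eapply Rle_trans.
      - apply (wint_le T _ (fun t => u1 L t ^ 2 + u2 L t ^ 2
        + ((1 + / eta) * ((u1 N t - u1 M t)^2 + (u2 N t - u2 M t)^2)
         + eta * (u1 M t ^ 2 + u2 M t ^ 2)))); auto. apply cont_plus; auto.
      - rewrite (wint_plus T (fun t => u1 L t ^ 2 + u2 L t ^ 2)); auto. unfold Q. lra. }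
    assert (HNM : Q N <= Q M + ((1 + / eta) * (A * (s N - s M)) + eta * A')).
    { apply Hab; intros t; specialize (Hpt t); apply Rabs_le_between in Hpt; lra. }
    assert (HMN' : Q M <= Q N + ((1 + / eta) * (A * (s N - s M)) + eta * A')).
    { apply Hab; intros t; specialize (Hpt t); apply Rabs_le_between in Hpt; lra. }
    apply Rabs_le; lra. }
  destruct (R_complete Q) as [I HI]; [|now exists I].
  intros e He.
  (* First [eta] makes the bounded term at most [e / 4]; then [del] does the same for the other,
     whose factor [1 + / eta] is now fixed. The [+ 1] keeps the denominators positive. *)
  set (eta := e / (4 * (A' + 1))).
  assert (Heta : 0 < eta) by (apply Rdiv_lt_0_compat; lra).
  set (del := e / (4 * ((1 + / eta) * (A + 1)))).
  assert (Hi : 0 < / eta) by now apply Rinv_0_lt_compat.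
  assert (Hdel : 0 < del) by (apply Rdiv_lt_0_compat; nra).
  destruct (CV_Cauchy s (exist _ l Hs) del Hdel) as [N0 HN0].
  assert (Hmain : forall M N, (N0 <= M)%nat -> (M <= N)%nat -> Rabs (Q N - Q M) < e).
  { intros M N HM HN. eapply Rle_lt_trans; [apply (Hcv M N eta HN Heta)|].
    assert (Hsd : s N - s M <= del).
    { specialize (HN0 N M ltac:(lia) ltac:(lia)). unfold R_dist in HN0.
      pose proof (Rle_abs (s N - s M)). lra. }
    assert (eta * A' <= e / 4).
    { unfold eta. apply Rmult_le_reg_r with (4 * (A' + 1)); [lra|]. field_simplify; nra. }
    assert ((1 + / eta) * (A * (s N - s M)) <= e / 4).
    { replace (e / 4) with ((1 + / eta) * ((A + 1) * del)) by (unfold del; field; repeat split; nra).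
      apply Rmult_le_compat_l; [lra|]. nra. }
    lra. }
  exists N0. intros N M HN HM. unfold R_dist.
  destruct (le_lt_dec M N) as [H|H].
  - now apply Hmain.
  - rewrite Rabs_minus_sym. apply Hmain; lia.
Qed.

(** * Tails of power series of exponent greater than one, and the standard integral *)

Lemma Rpower_telescope (x q : R) : 1 < x -> 0 < q ->
  Rpower x (- (1 + q)) <= / q * (Rpower (x - 1) (- q) - Rpower x (- q)).
Proof.
  intros Hx Hq.
  replace (- (1 + q)) with (- q + - (1)) by ring.
  rewrite Rpower_plus, (Rpower_Ropp x 1), Rpower_1 by lra.
  assert (Hp : 0 < Rpower x (- q)) by apply exp_pos.
  (* This and [1 + y <= e^y] replace the comparison of the sum with an integral. *)
  assert (Hln : ln (x - 1) <= ln x - / x).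
  { assert (Hy : 0 < (x - 1) / x) by (apply Rdiv_lt_0_compat; lra).
    pose proof (exp_ineq1_le (ln ((x - 1) / x))) as H.
    rewrite exp_ln in H by assumption.
    unfold Rdiv in H at 1. rewrite ln_mult, ln_Rinv in H; try lra.
    - replace ((x - 1) / x) with (1 - / x) in H by (field; lra). lra.
    - apply Rinv_0_lt_compat; lra. }
  assert (H : Rpower x (- q) * (1 + q * / x) <= Rpower (x - 1) (- q)).
  { unfold Rpower in *. apply Rle_trans with (exp (- q * ln x) * exp (q * / x)).
    - apply Rmult_le_compat_l; [lra | apply exp_ineq1_le].
    - rewrite <- exp_plus. apply exp_le. nra. }
  apply Rmult_le_reg_l with q; [assumption|].
  rewrite <- (Rmult_assoc q (/ q)), Rinv_r, Rmult_1_l by lra. lra.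
Qed.

(** The squares have exponent [2 nu = 1 + q] with [q > 0], so they telescope. The condition [2 <= n]
    keeps the base [n - 1] positive. *)
Lemma Rpower_tail (nu : R) (n N : nat) : / 2 < nu -> (2 <= n)%nat ->
  sum_f_R0 (fun k => Rpower (INR (n + k)) (- nu) ^ 2) N
  <= / (2 * nu - 1) * Rpower (INR (n - 1)) (- (2 * nu - 1)).
Proof.
  intros Hnu Hn. set (q := 2 * nu - 1). assert (Hq : 0 < q) by (unfold q; lra).
  assert (Hstep : forall k, Rpower (INR (n + k)) (- nu) ^ 2
     <= / q * (Rpower (INR (n + k - 1)) (- q) - Rpower (INR (n + k)) (- q))).
  { intros k. simpl pow. rewrite Rmult_1_r, <- Rpower_plus.
    replace (- nu + - nu) with (- (1 + q)) by (unfold q; ring).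
    rewrite minus_INR by lia. apply Rpower_telescope; [|assumption].
    apply (lt_INR 1); lia. }
  assert (H : sum_f_R0 (fun k => Rpower (INR (n + k)) (- nu) ^ 2) N
    <= / q * (Rpower (INR (n - 1)) (- q) - Rpower (INR (n + N)) (- q))).
  { induction N as [|N IH].
    - simpl sum_f_R0. specialize (Hstep 0%nat). now rewrite Nat.add_0_r in *.
    - rewrite tech5. specialize (Hstep (S N)).
      replace (n + S N - 1)%nat with (n + N)%nat in Hstep by lia. lra. }
  eapply Rle_trans; [exact H|].
  apply Rmult_le_compat_l; [left; now apply Rinv_0_lt_compat|].
  assert (0 < Rpower (INR (n + N)) (- q)) by apply exp_pos. lra.
Qed.

Lemma Rpower_small (q del : R) : 0 < q -> 0 < del ->
  exists n0, forall n, (n0 <= n)%nat -> Rpower (INR (n - 1)) (- q) <= del.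
Proof.
  intros Hq Hdel.
  (* The threshold is [del^{-1/q}]. *)
  destruct (INR_unbounded (exp (- ln del / q))) as [m Hm].
  exists (m + 1)%nat. intros n Hn.
  assert (Hmn : INR m <= INR (n - 1)) by (apply le_INR; lia).
  pose proof (exp_pos (- ln del / q)).
  unfold Rpower. rewrite <- (exp_ln del) by assumption. apply exp_le.
  assert (Hl : - ln del / q <= ln (INR (n - 1))).
  { rewrite <- (ln_exp (- ln del / q)). apply ln_le; lra. }
  apply (Rmult_le_compat_l q) in Hl; [|lra].
  replace (q * (- ln del / q)) with (- ln del) in Hl by (field; lra). lra.
Qed.

Lemma RInt_eq_wint (T : R) (F f : R -> R) : 0 < T -> cont f -> (forall t, F t = f t) ->
  RInt_eq (fun t => kweight T t * F t) 0 T (wint T f).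
Proof.
  intros HT Hf HF.
  assert (E : forall t, 0 <= t <= T -> sin (PI * t / T) * f t = kweight T t * F t).
  { intros t Ht. rewrite HF. unfold kweight.
    destruct (Rle_dec 0 t), (Rle_dec t T); auto; lra. }
  assert (H : ex_RInt (fun t => kweight T t * F t) 0 T).
  { apply (ex_RInt_ext (fun t => sin (PI * t / T) * f t)).
    - rewrite Rmin_left, Rmax_right by lra. intros t Ht. apply E. lra.
    - now apply cont_ex_RInt, weight_cont. }
  exists (ex_RInt_Reals_0 _ _ _ H). rewrite <- RInt_Reals. symmetry.
  unfold wint. apply RInt_ext. rewrite Rmin_left, Rmax_right by lra.
  intros t Ht. apply E. lra.
Qed.

(** * Truncated coefficients and convergence of the partial integrals *)

Definition trunc (M : nat) (C : nat -> Cpx) (k : nat) : Cpx :=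
  if le_dec k M then Czero else C k.

Definition truncR (M : nat) (x : nat -> R) (k : nat) : R :=
  if le_dec k M then 0 else x k.

Lemma sum_trunc (f f' : nat -> R) (M N : nat) : (M <= N)%nat ->
  (forall k, (k <= M)%nat -> f' k = 0) -> (forall k, (M < k)%nat -> f' k = f k) ->
  sum_f_R0 f' N = sum_f_R0 f N - sum_f_R0 f M.
Proof.
  intros HMN H0 H1.
  assert (Hz : sum_f_R0 f' M = 0).
  { rewrite (sum_eq f' (fun _ => 0)) by (intros; now apply H0).
    rewrite sum_cte. ring. }
  induction HMN as [|N HMN IH]; [lra|].
  simpl. rewrite IH, H1 by lia. ring.
Qed.

Lemma modes_trunc om C M N t : (M <= N)%nat ->
  modes om (trunc M C) N t = modes om C N t - modes om C M t.
Proof.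
  intros HMN. apply sum_trunc; auto; intros k Hk; unfold trunc;
    destruct (le_dec k M); try lia; auto.
  unfold mode, osc; simpl. ring.
Qed.

Lemma damped_trunc R_ r M N t : (M <= N)%nat ->
  damped (truncR M R_) r N t = damped R_ r N t - damped R_ r M t.
Proof.
  intros HMN. apply sum_trunc; auto; intros k Hk; unfold truncR;
    destruct (le_dec k M); try lia; auto. ring.
Qed.

Lemma modes_ext om C C' N t : (forall k, C k = C' k) -> modes om C N t = modes om C' N t.
Proof. intros H. apply sum_eq; intros k _. now rewrite H. Qed.

Lemma cmul_seq_trunc d D M k : cmul_seq d (trunc M D) k = trunc M (cmul_seq d D) k.
Proof.
  unfold cmul_seq, trunc. destruct (le_dec k M); auto.
  unfold Cmul, Czero; simpl. f_equal; ring.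
Qed.

Lemma mass_trunc C d D M k :
  mass (trunc M C) d (trunc M D) k = truncR M (mass C d D) k.
Proof.
  unfold mass, truncR. rewrite cmul_seq_trunc. unfold trunc.
  destruct (le_dec k M); auto. unfold Cnorm2; simpl. ring.
Qed.

(** A difference of partial sums is a partial sum with truncated coefficients, so bounds valid for
    all coefficients also control increments. *)
Lemma U1_trunc om ze C D R_ r M N t : (M <= N)%nat ->
  U1 om ze (trunc M C) (trunc M D) (truncR M R_) r N t
  = U1 om ze C D R_ r N t - U1 om ze C D R_ r M t.
Proof. intros H. unfold U1. rewrite !modes_trunc, damped_trunc by assumption. ring. Qed.

Lemma U2_trunc om ze C D c d M N t : (M <= N)%nat ->
  U2 om ze (trunc M C) (trunc M D) c d N t
  = U2 om ze C D c d N t - U2 om ze C D c d M t.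
Proof.
  intros H. unfold U2.
  rewrite !(modes_ext _ (cmul_seq _ (trunc M _)) (trunc M (cmul_seq _ _)))
    by (intros; apply cmul_seq_trunc).
  rewrite !modes_trunc by assumption. ring.
Qed.

Lemma sum_shift_le (f : nat -> R) (m N : nat) : (forall k, 0 <= f k) ->
  sum_f_R0 (fun k => f (m + k)%nat) N <= sum_f_R0 f (m + N).
Proof.
  intros Hf. induction N as [|N IH].
  - rewrite Nat.add_0_r. simpl. rewrite Nat.add_0_r.
    destruct m as [|m]; simpl; [lra|].
    pose proof (sum_nonneg f m (fun k _ => Hf k)). lra.
  - rewrite <- plus_n_Sm. simpl. rewrite <- plus_n_Sm. lra.
Qed.

Lemma nonneg_series_cv (f : nat -> R) (A : R) : (forall k, 0 <= f k) ->
  (forall N, sum_f_R0 f N <= A) -> exists l, Un_cv (sum_f_R0 f) l.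
Proof.
  intros Hf HA. apply Un_cv_crit.
  - intros N. simpl. specialize (Hf (S N)). lra.
  - exists A. intros y [N ->]. apply HA.
Qed.

Lemma Un_cv_le_compat (u v : nat -> R) (a b : R) :
  (forall n, u n <= v n) -> Un_cv u a -> Un_cv v b -> a <= b.
Proof.
  intros H Hu Hv. destruct (Rle_lt_dec a b) as [|Hlt]; [assumption|exfalso].
  destruct (Hu ((a - b) / 2)) as [N1 H1]; [lra|].
  destruct (Hv ((a - b) / 2)) as [N2 H2]; [lra|].
  specialize (H1 (max N1 N2) ltac:(lia)). specialize (H2 (max N1 N2) ltac:(lia)).
  specialize (H (max N1 N2)). unfold R_dist in *.
  apply Rabs_def2 in H1, H2. lra.
Qed.

(** Bounds the energy by the unweighted mass, uniformly in the index; [beta0] allows for negative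
    imaginary parts of [ze]. *)
Lemma Kd_wgt_upper (T beta beta0 : R) : 0 < T -> - beta0 <= beta ->
  Kd T beta * wgt T beta <= / (PI / T) * (1 + exp (2 * beta0 * T)).
Proof.
  intros HT Hb. pose proof (PI_div_pos T HT) as Hp. set (b := PI / T) in *.
  apply Rmult_le_compat.
  - left; now apply Kd_pos.
  - pose proof (wgt_ge_1 T beta). lra.
  - unfold Kd. fold b. replace (/ b) with (b / b^2) by (field; lra).
    pose proof (pow2_ge_0 beta). apply Rmult_le_compat_l; [lra|].
    apply Rinv_le_contravar; nra.
  - unfold wgt. apply Rplus_le_compat_l, exp_le. nra.
Qed.

Lemma wgt_le_2 (T beta : R) : 0 < T -> 0 <= beta -> wgt T beta <= 2.
Proof.
  intros HT Hb. unfold wgt.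
  assert (exp (-2 * beta * T) <= exp 0) by (apply exp_le; nra).
  rewrite exp_0 in *. lra.
Qed.

(** The energy lies between constant multiples of the weighted and the plain mass. The upper bound
    on truncated coefficients gives convergence of the integrals, and the lower bound passes to the
    limit. *)
Lemma inverse_inequality_of_energy_bounds (T kap0 G beta0 A mu : R)
  (om ze c d : nat -> Cpx) (r v : nat -> R) :
  0 < T -> 0 < kap0 -> 0 < G ->
  (forall k, 0 <= im (om k)) -> (forall k, - beta0 <= im (ze k)) -> 0 <= beta0 ->
  (forall k, G <= Kd T (im (om k))) -> (forall k, G <= Kd T (im (ze k))) ->
  (forall (C D : nat -> Cpx) (R_ : nat -> R) (N : nat),
    (forall k, Rabs (R_ k) <= mu * v k * sqrt (mass C d D k)) ->
    let E := cenergy T om C N + cenergy T ze (cmul_seq d D) N in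
    let Q := wint T (fun t => U1 om ze C D R_ r N t ^ 2 + U2 om ze C D c d N t ^ 2) in
    kap0 * E <= Q <= 40 * E) ->
  forall (C D : nat -> Cpx) (R_ : nat -> R),
  (forall k, Rabs (R_ k) <= mu * v k * sqrt (mass C d D k)) ->
  (forall N, sum_f_R0 (mass C d D) N <= A) ->
  exists I S,
    Un_cv (fun N => wint T (fun t => U1 om ze C D R_ r N t ^ 2 + U2 om ze C D c d N t ^ 2)) I /\
    Un_cv (sum_f_R0 (fun k => wgt T (im (om k)) * mass C d D k)) S /\
    kap0 * (G / 2) * S <= I.
Proof.
  intros HT Hk0 HG Hom Hze Hb0 HGom HGze Hcore C D R_ HR HA.
  assert (HA0 : 0 <= A).
  { eapply Rle_trans; [|apply (HA 0%nat)]. apply mass_nonneg. }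
  assert (Hb := PI_div_pos T HT).
  set (A1 := / (PI / T) * (1 + exp (2 * beta0 * T))).
  assert (HA1 : 0 <= A1).
  { unfold A1. pose proof (exp_pos (2 * beta0 * T)).
    apply Rmult_le_pos; [left; now apply Rinv_0_lt_compat | lra]. }
  assert (Hup : forall C D N, cenergy T om C N + cenergy T ze (cmul_seq d D) N
     <= A1 * sum_f_R0 (mass C d D) N).
  { intros C' D' N. unfold cenergy, energy. rewrite <- plus_sum, <- sum_scal.
    apply sum_Rle; intros k _. unfold mass. rewrite <- !Cnorm2_sqr, <- !Rmult_assoc.
    rewrite Rmult_plus_distr_l. apply Rplus_le_compat; apply Rmult_le_compat_r;
      try apply Cnorm2_nonneg; apply Kd_wgt_upper; auto. specialize (Hom k). lra. }
  (* The weight at [om] also multiplies the [d D] terms, whose energy carries the weight at [ze]. As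
     the former is at most [2] and the latter at least [1], a factor [1/2] suffices. *)
  assert (Hlow : forall N, G / 2 * sum_f_R0 (fun k => wgt T (im (om k)) * mass C d D k) N
     <= cenergy T om C N + cenergy T ze (cmul_seq d D) N).
  { intros N. unfold cenergy, energy. rewrite <- plus_sum, <- sum_scal.
    apply sum_Rle; intros k _. unfold mass. rewrite <- !Cnorm2_sqr, <- !Rmult_assoc.
    pose proof (wgt_ge_1 T (im (om k))). pose proof (wgt_ge_1 T (im (ze k))).
    pose proof (wgt_le_2 T (im (om k)) HT (Hom k)).
    specialize (HGom k). specialize (HGze k).
    rewrite Rmult_plus_distr_l. apply Rplus_le_compat; apply Rmult_le_compat_r;
      try apply Cnorm2_nonneg; nra. }
  destruct (nonneg_series_cv (mass C d D) A) as [l Hl]; [apply mass_nonneg | assumption |].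
  destruct (nonneg_series_cv (fun k => wgt T (im (om k)) * mass C d D k) (2 * A)) as [S HS].
  { intros k. apply Rmult_le_pos; [|apply mass_nonneg]. pose proof (wgt_ge_1 T (im (om k))). lra. }
  { intros N. apply Rle_trans with (2 * sum_f_R0 (mass C d D) N).
    - rewrite <- sum_scal. apply sum_Rle; intros k _.
      apply Rmult_le_compat_r; [apply mass_nonneg | now apply wgt_le_2].
    - specialize (HA N). lra. }
  destruct (form_cauchy T (40 * A1) (40 * (A1 * A)) l
    (U1 om ze C D R_ r) (U2 om ze C D c d) (sum_f_R0 (mass C d D))) as [I HI]; auto.
  - intros; apply U1_cont.
  - intros; apply U2_cont.
  - lra.
  - apply Rmult_le_pos; [lra|]. now apply Rmult_le_pos.
  - intros M N HMN.
    rewrite (wint_ext T _ (fun t => U1 om ze (trunc M C) (trunc M D) (truncR M R_) r N t ^ 2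
      + U2 om ze (trunc M C) (trunc M D) c d N t ^ 2))
      by (intros t; now rewrite U1_trunc, U2_trunc).
    eapply Rle_trans.
    + apply Hcore. intros k. rewrite mass_trunc. unfold truncR.
      destruct (le_dec k M); [rewrite Rabs_R0, sqrt_0; lra | apply HR].
    + rewrite Rmult_assoc. apply Rmult_le_compat_l; [lra|].
      eapply Rle_trans; [apply Hup|]. apply Rmult_le_compat_l; [assumption|]. right.
      apply sum_trunc; auto; intros k Hk; rewrite mass_trunc; unfold truncR;
        destruct (le_dec k M); auto; lia.
  - intros N. eapply Rle_trans; [apply Hcore, HR|]. apply Rmult_le_compat_l; [lra|].
    eapply Rle_trans; [apply Hup|]. apply Rmult_le_compat_l; auto.
  - exists I, S. split; [exact HI|]. split; [exact HS|].
    apply (Un_cv_le_compat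
      (fun N => kap0 * (G / 2) * sum_f_R0 (fun k => wgt T (im (om k)) * mass C d D k) N)
      (fun N => wint T (fun t => U1 om ze C D R_ r N t ^ 2 + U2 om ze C D c d N t ^ 2))).
    + intros N. eapply Rle_trans; [|apply Hcore, HR].
      rewrite Rmult_assoc. apply Rmult_le_compat_l; [lra | apply Hlow].
    + apply (CV_mult (fun _ => kap0 * (G / 2))); [|exact HS].
      intros e He. exists 0%nat. intros n _. unfold R_dist. now rewrite Rminus_diag, Rabs_R0.
    + exact HI.
Qed.

(** * Reduction of the complex signals to real ones *)

Lemma CsumN_re (f : nat -> Cpx) (N : nat) : re (CsumN f N) = sum_f_R0 (fun k => re (f k)) N.
Proof. induction N as [|N IH]; simpl; congruence. Qed.

Lemma CsumN_im_0 (f : nat -> Cpx) (N : nat) :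
  (forall k, im (f k) = 0) -> im (CsumN f N) = 0.
Proof. intros H. induction N as [|N IH]; simpl; rewrite ?IH, H; lra. Qed.

(** The second summand is the conjugate of the first, since [- i conj w = conj (i w)]. *)
Lemma conj_pair (w z : Cpx) (t : R) :
  Cadd (Cmul z (Cexp (Cmul Ci (Cmul w (RtoC t)))))
    (Cmul (Cconj z) (Cexp (Cmul (Cmul (RtoC (-1)) Ci) (Cmul (Cconj w) (RtoC t)))))
  = RtoC (mode (re z) (im z) (im w) (re w) t).
Proof.
  unfold Cadd, Cmul, Cexp, Cconj, RtoC, Ci, mode, osc; simpl.
  replace (0 * (re w * t - im w * 0) - 1 * (re w * 0 + im w * t)) with (- im w * t) by ring.
  replace (0 * (re w * 0 + im w * t) + 1 * (re w * t - im w * 0)) with (re w * t) by ring.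
  replace ((-1 * 0 - 0 * 1) * (re w * t - - im w * 0) - (-1 * 1 + 0 * 0) * (re w * 0 + - im w * t))
    with (- im w * t) by ring.
  replace ((-1 * 0 - 0 * 1) * (re w * 0 + - im w * t) + (-1 * 1 + 0 * 0) * (re w * t - - im w * 0))
    with (- (re w * t)) by ring.
  rewrite cos_neg, sin_neg. f_equal; ring.
Qed.

Lemma Cadd_assoc (x y z : Cpx) : Cadd x (Cadd y z) = Cadd (Cadd x y) z.
Proof. unfold Cadd; simpl. f_equal; ring. Qed.

Lemma RtoC_add (x y : R) : Cadd (RtoC x) (RtoC y) = RtoC (x + y).
Proof. unfold Cadd, RtoC; simpl. f_equal; ring. Qed.

Lemma u1_term_real om ze C D R_ r n t :
  u1_term om ze C D R_ r n t
  = RtoC (mode (re (C n)) (im (C n)) (im (om n)) (re (om n)) t + R_ n * exp (r n * t)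
          + mode (re (D n)) (im (D n)) (im (ze n)) (re (ze n)) t).
Proof.
  unfold u1_term. rewrite conj_pair, Cadd_assoc, conj_pair, !RtoC_add. f_equal. ring.
Qed.

Lemma u2_term_real om ze C D c d n t :
  u2_term om ze C D c d n t
  = RtoC (mode (re (cmul_seq d D n)) (im (cmul_seq d D n)) (im (ze n)) (re (ze n)) t
          + mode (re (cmul_seq c C n)) (im (cmul_seq c C n)) (im (om n)) (re (om n)) t).
Proof.
  unfold u2_term. fold (cmul_seq d D n) (cmul_seq c C n).
  rewrite conj_pair, Cadd_assoc, conj_pair, !RtoC_add. reflexivity.
Qed.

Lemma u1_partial_norm om ze C D R_ r n0 N t :
  Cnorm2 (u1_partial om ze C D R_ r n0 N t)
  = U1 (fun k => om (n0 + k)%nat) (fun k => ze (n0 + k)%nat) (fun k => C (n0 + k)%nat)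
       (fun k => D (n0 + k)%nat) (fun k => R_ (n0 + k)%nat) (fun k => r (n0 + k)%nat) N t ^ 2.
Proof.
  rewrite Cnorm2_sqr. unfold u1_partial.
  rewrite CsumN_im_0 by (intros; now rewrite u1_term_real).
  rewrite CsumN_re. rewrite pow_ne_zero, Rplus_0_r by lia. f_equal.
  unfold U1, modes, damped. rewrite <- !plus_sum. apply sum_eq; intros k _.
  now rewrite u1_term_real.
Qed.

Lemma u2_partial_norm om ze C D c d n0 N t :
  Cnorm2 (u2_partial om ze C D c d n0 N t)
  = U2 (fun k => om (n0 + k)%nat) (fun k => ze (n0 + k)%nat) (fun k => C (n0 + k)%nat)
       (fun k => D (n0 + k)%nat) (fun k => c (n0 + k)%nat) (fun k => d (n0 + k)%nat) N t ^ 2.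
Proof.
  rewrite Cnorm2_sqr. unfold u2_partial.
  rewrite CsumN_im_0 by (intros; now rewrite u2_term_real).
  rewrite CsumN_re. rewrite pow_ne_zero, Rplus_0_r by lia. f_equal.
  unfold U2, modes. rewrite <- !plus_sum. apply sum_eq; intros k _.
  now rewrite u2_term_real.
Qed.

(** * Choice of the constants and of the starting index *)

Lemma gap_const_le_Kd (T gam alpha eps g beta : R) :
  0 < T -> 0 < eps < 1 -> 0 < gam -> g^2 = gam^2 * (1 - eps / 2) ->
  4 * (PI / T)^2 <= gam^2 * (1 - eps) - 16 * alpha^2 * (1 + eps) ->
  beta^2 <= alpha^2 * (1 + eps) ->
  gap_const T g <= (1 - eps) / (1 - eps / 2) * Kd T beta.
Proof.
  intros HT Heps Hgam Hg HD Hbeta. unfold gap_const, Kd.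
  pose proof (PI_div_pos T HT) as Hb. set (b := PI / T) in *.
  rewrite Hg. assert (Hgam2 : 0 < gam^2) by nra.
  assert (Hpos : 0 < 4 * beta^2 + b^2) by (pose proof (pow2_ge_0 beta); nra).
  (* With common factors set aside, the claim is [4 (4 beta^2 + b^2) <= gam^2 (1 - eps)], which the
     condition on [T] and the bound on [beta] give together. *)
  replace (4 * b / (gam^2 * (1 - eps / 2)))
    with (b / (1 - eps / 2) / gam^2 * (4 * (4 * beta^2 + b^2)) * / (4 * beta^2 + b^2))
    by (field; repeat split; lra).
  replace ((1 - eps) / (1 - eps / 2) * (b / (4 * beta^2 + b^2)))
    with (b / (1 - eps / 2) / gam^2 * (gam^2 * (1 - eps)) * / (4 * beta^2 + b^2))
    by (field; repeat split; lra).
  apply Rmult_le_compat_r; [left; now apply Rinv_0_lt_compat|].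
  apply Rmult_le_compat_l; [|lra].
  left. clearbody b. repeat apply Rdiv_lt_0_compat; lra.
Qed.

Lemma liminf_eventually (u : nat -> R) (gam g : R) :
  liminf_eq (fun n => u (S n) - u n) gam -> g < gam ->
  exists N, forall n, (N <= n)%nat -> g <= u (S n) - u n.
Proof.
  intros [H _] Hg. destruct (H (gam - g)) as [N HN]; [lra|].
  exists N. intros n Hn. specialize (HN n Hn). simpl in HN. lra.
Qed.

(** Growth is at least linear. Applied to real parts, this makes the first frequency large, [c n]
    small and [d n] large. *)
Lemma gap_unbounded (u : nat -> R) (g L : R) (N : nat) : 0 < g ->
  (forall n, (N <= n)%nat -> g <= u (S n) - u n) ->
  exists N', forall n, (N' <= n)%nat -> L <= u n.
Proof.
  intros Hg Hgap.
  assert (Hlin : forall k, u N + g * INR k <= u (N + k)%nat).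
  { induction k as [|k IH]; [rewrite Nat.add_0_r; simpl; lra|].
    rewrite S_INR, <- plus_n_Sm. specialize (Hgap (N + k)%nat ltac:(lia)). lra. }
  destruct (INR_unbounded ((L - u N) / g)) as [m Hm].
  exists (N + m)%nat. intros n Hn. replace n with (N + (n - N))%nat by lia.
  eapply Rle_trans; [|apply Hlin].
  assert (INR m <= INR (n - N)) by (apply le_INR; lia).
  assert (Hq : (L - u N) / g < INR (n - N)) by lra.
  apply (Rmult_lt_compat_l g) in Hq; [|assumption].
  replace (g * ((L - u N) / g)) with (L - u N) in Hq by (field; lra). lra.
Qed.

Lemma Cabs_sqr (z : Cpx) : Cabs z ^ 2 = Cnorm2 z.
Proof. apply pow2_sqrt, Cnorm2_nonneg. Qed.

Lemma Cnorm2_ge_re (z : Cpx) (L : R) : 0 <= L -> L <= re z -> L^2 <= Cnorm2 z.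
Proof. intros H0 H. rewrite Cnorm2_sqr. pose proof (pow2_ge_0 (im z)). nra. Qed.

Theorem theorem5p9
  (om ze c d : nat -> Cpx) (r : nat -> R)
  (gam alpha chi : R) (n' : nat) (mu nu M c1 c2 : R)
  (Hgam : 0 < gam) (Halpha : 0 < alpha) (Hchi : chi < 0)
  (Hmu : 0 < mu) (Hnu : / 2 < nu) (HM : 0 < M) (Hc1 : 0 < c1) (Hc12 : c1 <= c2)
  (* (H1) *)
  (H1om : liminf_eq (fun n => re (om (S n)) - re (om n)) gam)
  (H1ze : liminf_eq (fun n => re (ze (S n)) - re (ze n)) gam)
  (* (H2) *)
  (H2om : Un_cv (fun n => im (om n)) alpha)
  (H2r : Un_cv r chi)
  (H2ze : Un_cv (fun n => im (ze n)) 0)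
  (* (H3) *)
  (H3om : forall n, (1 <= n)%nat -> om n <> Czero)
  (H3ze : forall n, (1 <= n)%nat -> ze n <> Czero)
  (H3d : forall n, (1 <= n)%nat -> c1 * Cabs (ze n) <= Cabs (d n) <= c2 * Cabs (ze n))
  (H3c : forall n, (1 <= n)%nat -> Cabs (c n) <= M / Cabs (om n))
  (* gamma > 4 alpha *)
  (Hga : 4 * alpha < gam) :
  forall eps : R,
    0 < eps < (gam ^ 2 - 16 * alpha ^ 2) / (gam ^ 2 + 16 * alpha ^ 2) ->
  exists n0 : nat, (1 <= n0)%nat /\
  forall T : R,
    2 * PI / sqrt (gam ^ 2 * (1 - eps) - 16 * alpha ^ 2 * (1 + eps)) < T ->
  exists cT : R, 0 < cT /\
  forall (C D : nat -> Cpx) (R_ : nat -> R),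
    (* (H4) *)
    (forall n, (n' <= n)%nat -> (1 <= n)%nat ->
       Rabs (R_ n) <= mu * Rpower (INR n) (- nu)
                        * sqrt (Cnorm2 (C n) + Cnorm2 (Cmul (d n) (D n)))) ->
    (forall n, (1 <= n)%nat -> (n <= n')%nat ->
       Rabs (R_ n) <= mu * sqrt (Cnorm2 (C n) + Cnorm2 (Cmul (d n) (D n)))) ->
    (* (H5) *)
    (exists L, Un_cv (fun N => sum_f_R0
        (fun k => Cnorm2 (C (S k)) + Cnorm2 (Cmul (d (S k)) (D (S k)))) N) L) ->
    (* the weighted integral of |u_1^{n0}|^2 + |u_2^{n0}|^2, defined as the limit
       of the integrals computed with the partial sums, exists; the right-hand
       series converges; and the inequality holds *)
    exists (Iseq : nat -> R) (I S : R),
      (forall N, RInt_eq (fun t => kweight T t *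
           (Cnorm2 (u1_partial om ze C D R_ r n0 N t)
            + Cnorm2 (u2_partial om ze C D c d n0 N t))) 0 T (Iseq N)) /\
      Un_cv Iseq I /\
      Un_cv (fun N => sum_f_R0 (fun k =>
          (1 + exp (-2 * im (om (n0 + k)%nat) * T))
          * (Cnorm2 (C (n0 + k)%nat) + Cnorm2 (Cmul (d (n0 + k)%nat) (D (n0 + k)%nat)))) N) S /\
      cT * S <= I.
Proof.
  intros eps [Heps Hepslt].
  assert (Hga2 : 0 < gam^2 - 16 * alpha^2) by nra.
  assert (Hgp : 0 < gam^2 + 16 * alpha^2) by nra.
  (* Positivity of the radicand is the upper bound on [eps] with the denominator cleared. *)
  assert (HD : 0 < gam^2 * (1 - eps) - 16 * alpha^2 * (1 + eps)).
  { apply (Rmult_lt_compat_r (gam^2 + 16 * alpha^2)) in Hepslt; [|assumption].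
    replace ((gam ^ 2 - 16 * alpha ^ 2) / (gam ^ 2 + 16 * alpha ^ 2) * (gam ^ 2 + 16 * alpha ^ 2))
      with (gam^2 - 16 * alpha^2) in Hepslt by (field; lra). lra. }
  assert (Halpha2 : 0 < alpha^2) by nra.
  assert (Hgam2 : 0 < gam^2) by nra.
  assert (Heps1 : eps < 1) by nra.
  (* Half of [eps] makes [g < gam], so that [g] is eventually a true gap; the other half makes
     [rho < 1]. *)
  set (g := gam * sqrt (1 - eps / 2)).
  assert (Hg2 : g^2 = gam^2 * (1 - eps / 2)).
  { unfold g. rewrite Rpow_mult_distr, pow2_sqrt by lra. reflexivity. }
  assert (Hg : 0 < g) by (apply Rmult_lt_0_compat; [assumption | apply sqrt_lt_R0; lra]).
  assert (Hggam : g < gam) by nra.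
  set (rho := (1 - eps) / (1 - eps / 2)).
  assert (Hrho0 : 0 < rho) by (apply Rdiv_lt_0_compat; lra).
  assert (Hrho1 : rho < 1).
  { unfold rho. apply Rmult_lt_reg_r with (1 - eps / 2); [lra|]. field_simplify; lra. }
  (* Midway between [rho] and [1], leaving room for the sum frequencies; [eta] is the largest value
     [energy_bounds] admits. *)
  set (rho' := (1 + rho) / 2).
  set (eta := (1 - rho') / 20).
  assert (Heta : 0 < eta) by (unfold eta, rho'; lra).
  destruct (INR_unbounded (2 / (1 - rho))) as [P0 HP0].
  set (P := S P0).
  assert (HPpos : 0 < INR P) by (apply lt_0_INR; unfold P; lia).
  assert (HP : rho * (1 + / INR P) <= rho').
  { assert (Hi : / INR P <= (1 - rho) / 2).
    { replace ((1 - rho) / 2) with (/ (2 / (1 - rho))) by (field; lra).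
      apply Rinv_le_contravar; [apply Rdiv_lt_0_compat; lra|].
      unfold P. rewrite S_INR. lra. }
    assert (0 < / INR P) by now apply Rinv_0_lt_compat.
    unfold rho'. nra. }
  set (x := - chi / 2). assert (Hx : 0 < x) by (unfold x; lra).
  (* Solves [PI / T / (2 x^2) * mu^2 V = eta * gap_const T g]. The factor [PI / T] cancels, so [V],
     and with it [n0], does not depend on [T]. *)
  set (V := 8 * x^2 * eta / (g^2 * mu^2)).
  assert (Hg2p : 0 < g^2) by nra. assert (Hmu2 : 0 < mu^2) by nra.
  assert (Hx2 : 0 < x^2) by nra.
  assert (HV : 0 < V) by (apply Rdiv_lt_0_compat; apply Rmult_lt_0_compat; lra).
  destruct (liminf_eventually _ gam g H1om Hggam) as [N1 HN1].
  destruct (liminf_eventually _ gam g H1ze Hggam) as [N2 HN2].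
  (* Chosen so that [(1 + eps / 4)^2 <= 1 + eps], which bounds [(im (om n))^2] by
     [alpha^2 (1 + eps)]. *)
  destruct (H2om (alpha * (eps / 4))) as [N3 HN3]; [nra|].
  destruct (H2ze alpha Halpha) as [N4 HN4].
  destruct (H2r x Hx) as [N5 HN5].
  destruct (gap_unbounded _ g (g * INR P) N1 Hg HN1) as [N6 HN6].
  destruct (gap_unbounded _ g (g * INR P) N2 Hg HN2) as [N7 HN7].
  assert (Hse : 0 < sqrt eta) by now apply sqrt_lt_R0.
  destruct (gap_unbounded _ g (M / sqrt eta) N1 Hg HN1) as [N8 HN8].
  destruct (gap_unbounded _ g (/ (c1 * sqrt eta)) N2 Hg HN2) as [N9 HN9].
  destruct (Rpower_small (2 * nu - 1) (V * (2 * nu - 1))) as [N10 HN10]; [lra | nra |].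
  (* The sum stands in for a maximum; [n'] puts every index under the decaying bound of (H4), and
     [2] is the start required by [Rpower_tail]. *)
  set (n0 := (N1 + N2 + N3 + N4 + N5 + N6 + N7 + N8 + N9 + N10 + n' + 2)%nat).
  exists n0. split; [lia|].
  intros T HT.
  assert (HDs := sqrt_lt_R0 _ HD).
  set (Del := gam ^ 2 * (1 - eps) - 16 * alpha ^ 2 * (1 + eps)) in *.
  assert (Hpi := PI_RGT_0).
  assert (HT0 : 0 < T).
  { eapply Rlt_trans; [|exact HT]. apply Rdiv_lt_0_compat; lra. }
  assert (Hb := PI_div_pos T HT0).
  assert (Hb2 : 4 * (PI / T)^2 <= Del).
  { apply (Rmult_lt_compat_r (sqrt Del)) in HT; [|assumption].
    replace (2 * PI / sqrt Del * sqrt Del) with (2 * PI) in HT by (field; lra).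
    assert (2 * (PI / T) < sqrt Del).
    { apply Rmult_lt_reg_r with T; [assumption|].
      replace (2 * (PI / T) * T) with (2 * PI) by (field; lra). lra. }
    rewrite <- (pow2_sqrt Del) by lra. nra. }
  assert (HgT : 2 * PI <= g * T).
  { assert (4 * (PI / T)^2 <= g^2) by (rewrite Hg2; unfold Del in Hb2; nra).
    assert (2 * (PI / T) <= g) by nra.
    replace (2 * PI) with (2 * (PI / T) * T) by (field; lra).
    apply Rmult_le_compat_r; lra. }
  set (G := gap_const T g). assert (HG : 0 < G) by now apply gap_const_pos.
  exists ((1 - rho') / 2 * (G / 2)).
  split; [apply Rmult_lt_0_compat; unfold rho'; lra|].
  intros C D R_ H4 _ [L HL].
  set (om' := fun k => om (n0 + k)%nat). set (ze' := fun k => ze (n0 + k)%nat).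
  set (c' := fun k => c (n0 + k)%nat). set (d' := fun k => d (n0 + k)%nat).
  set (r' := fun k => r (n0 + k)%nat).
  set (C' := fun k => C (n0 + k)%nat). set (D' := fun k => D (n0 + k)%nat).
  set (R' := fun k => R_ (n0 + k)%nat).
  set (v := fun k => Rpower (INR (n0 + k)) (- nu)).
  assert (Him : forall k, 0 <= im (om' k) /\ im (om' k)^2 <= alpha^2 * (1 + eps)).
  { intros k. specialize (HN3 (n0 + k)%nat ltac:(lia)).
    unfold R_dist in HN3. apply Rabs_def2 in HN3. fold (om' k) in HN3.
    split; [nra|].
    apply Rle_trans with ((alpha * (1 + eps / 4))^2); [apply pow_incr; nra|].
    rewrite Rpow_mult_distr. apply Rmult_le_compat_l; nra. }
  assert (Hiz : forall k, - alpha <= im (ze' k) /\ im (ze' k)^2 <= alpha^2 * (1 + eps)).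
  { intros k. specialize (HN4 (n0 + k)%nat ltac:(lia)).
    unfold R_dist in HN4. apply Rabs_def2 in HN4. fold (ze' k) in HN4.
    split; nra. }
  assert (HGom : forall k, G <= rho * Kd T (im (om' k))).
  { intros k. apply (gap_const_le_Kd T gam alpha eps); auto. apply Him. }
  assert (HGze : forall k, G <= rho * Kd T (im (ze' k))).
  { intros k. apply (gap_const_le_Kd T gam alpha eps); auto. apply Hiz. }
  destruct (inverse_inequality_of_energy_bounds T ((1 - rho') / 2) G alpha L mu
    om' ze' c' d' r' v) with (C := C') (D := D') (R_ := R') as (I & S & HI & HS & HIS);
    auto; try lra.
  - unfold rho'; lra.
  - apply Him.
  - apply Hiz.
  - intros k. specialize (HGom k). pose proof (Kd_pos T (im (om' k)) HT0). nra.
  - intros k. specialize (HGze k). pose proof (Kd_pos T (im (ze' k)) HT0). nra.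
  - apply (energy_bounds T g rho rho' x eta mu V P); auto; try lra.
    + unfold P; lia.
    + apply HN6; lia.
    + intros k. unfold om'. rewrite <- plus_n_Sm. apply HN1; lia.
    + apply HN7; lia.
    + intros k. unfold ze'. rewrite <- plus_n_Sm. apply HN2; lia.
    + unfold eta; lra.
    + intros k. rewrite <- Cabs_sqr.
      assert (Hn : (1 <= n0 + k)%nat) by lia.
      specialize (HN8 (n0 + k)%nat ltac:(lia)).
      apply Rle_trans with ((sqrt eta)^2); [|right; apply pow2_sqrt; lra].
      apply pow_incr. split; [apply sqrt_pos|].
      eapply Rle_trans; [apply (H3c _ Hn)|].
      assert (HMe : 0 < M / sqrt eta) by now apply Rdiv_lt_0_compat.
      assert (Hab : M / sqrt eta <= Cabs (om (n0 + k)%nat)).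
      { unfold Cabs. rewrite <- (sqrt_pow2 (M / sqrt eta)) by lra.
        apply sqrt_le_1_alt, Cnorm2_ge_re; lra. }
      replace (sqrt eta) with (M / (M / sqrt eta)) by (field; lra).
      apply Rmult_le_compat_l; [lra|]. now apply Rinv_le_contravar.
    + intros k. rewrite <- Cabs_sqr.
      assert (Hn : (1 <= n0 + k)%nat) by lia.
      specialize (HN9 (n0 + k)%nat ltac:(lia)).
      rewrite <- (pow2_sqrt eta) by lra. rewrite <- Rpow_mult_distr.
      assert (Hce : 0 < / (c1 * sqrt eta)) by (apply Rinv_0_lt_compat; nra).
      assert (Hab : / (c1 * sqrt eta) <= Cabs (ze (n0 + k)%nat)).
      { unfold Cabs. rewrite <- (sqrt_pow2 (/ (c1 * sqrt eta))) by lra.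
        apply sqrt_le_1_alt, Cnorm2_ge_re; lra. }
      assert (H1 : 1 <= sqrt eta * Cabs (d' k)).
      { apply Rle_trans with (sqrt eta * (c1 * Cabs (ze (n0 + k)%nat))).
        - replace 1 with (sqrt eta * (c1 * / (c1 * sqrt eta))) by (field; lra).
          repeat (apply Rmult_le_compat_l; [lra|]). exact Hab.
        - apply Rmult_le_compat_l; [lra|]. apply (H3d _ Hn). }
      nra.
    + intros k. specialize (HN5 (n0 + k)%nat ltac:(lia)).
      unfold R_dist in HN5. apply Rabs_def2 in HN5. unfold r', x in *. lra.
    + intros N. unfold v. eapply Rle_trans; [apply Rpower_tail; [assumption | lia]|].
      replace V with (/ (2 * nu - 1) * (V * (2 * nu - 1))) by (field; lra).
      apply Rmult_le_compat_l; [left; apply Rinv_0_lt_compat; lra|]. apply HN10; lia.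
    + unfold V, gap_const. right. field. repeat split; lra.
  - intros k. apply (H4 (n0 + k)%nat); lia.
  - intros N. set (s := fun k => Cnorm2 (C (Datatypes.S k)) + Cnorm2 (Cmul (d (Datatypes.S k)) (D (Datatypes.S k)))) in HL.
    assert (Hs : forall k, 0 <= s k).
    { intros k. apply Rplus_le_le_0_compat; apply Cnorm2_nonneg. }
    (* (H5) sums from index [1], so the term of index [n0 + k] stands at position [n0 - 1 + k] of
       [s]. *)
    apply Rle_trans with (sum_f_R0 (fun k => s (n0 - 1 + k)%nat) N).
    + right. apply sum_eq; intros k _. unfold s.
      replace (Datatypes.S (n0 - 1 + k)) with (n0 + k)%nat by lia. reflexivity.
    + eapply Rle_trans; [now apply sum_shift_le|].
      apply (growing_ineq (sum_f_R0 s)); [|exact HL].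
      intros n. simpl. specialize (Hs (Datatypes.S n)). lra.
  - eexists; exists I, S. split; [|split; [exact HI|split; [exact HS | exact HIS]]].
    intros N. apply RInt_eq_wint; [assumption | |].
    + apply cont_plus; apply cont_sqr; [apply U1_cont | apply U2_cont].
    + intros t. rewrite u1_partial_norm, u2_partial_norm. reflexivity.
Qed.
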